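(* Let $H$ be an arbitrary finite graph with chromatic number $\chi(H)$ at least two, and let $x\in[0,1]$. Suppose that $W:\Omega^2\to[0,1]$ is a graphon with minimum degree $$\delta(W)\ge x\left(1-\frac{1}{\chi_{\mathrm{cr}}(H)}\right)+(1-x)\left(1-\frac{1}{\chi(H)-1}\right).$$ Then $\mathsf{fcov}(H,W)\ge\frac{x}{v(H)}$. Furthermore, if $x<1$ and $\mathsf{fcov}(H,W)=\frac{x}{v(H)}$, then $W$ is a bottleneck graphon with parameters $x$ and $\chi_{\mathrm{cr}}(H)$.
   Context: $\Omega$ is an atomless Borel probability space with probability measure $\nu$; $\nu^k$ is the product measure on $\Omega^k$. A graphon is a symmetric measurable function $W:\Omega^2\to[0,1]$. Graphs are finite and simple; $v(H)$ is the number of vertices of $H$. The support of a function $f$ is $\mathrm{supp}\,f=\{x:f(x)\ne0\}$. Minimum degree: $\deg_W(x)=\int_{y\in\Omega}W(x,y)\,d\nu(y)$, and $\delta(W)$ is the essential infimum of $\deg_W$ over $\Omega$. Critical chromatic number: if $H$ has order $h$ and chromatic number $r\ge2$, and $\ell$ is the order of the smallest possible color class in any proper $r$-coloring of $H$, then $\chi_{\mathrm{cr}}(H)=\frac{(r-1)h}{h-\ell}$; one has $\chi_{\mathrm{cr}}(H)\in(\chi(H)-1,\chi(H)]$. Fractional cover: for a graph $F$ on vertex set $[k]$, let $W^{\otimes F}(x_1,\dots,x_k)=\prod_{1\le i<j\le k,\ ij\in E(F)}W(x_i,x_j)$. A measurable function $\mathfrak{c}:\Omega\to[0,1]$ is a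 fractional $F$-cover in $W$ if $$\nu^k\left((\mathrm{supp}\,W^{\otimes F})\cap\left\{(x_1,\dots,x_k)\in\Omega^k:\sum_{i=1}^k\mathfrak{c}(x_i)<1\right\}\right)=0 .$$ Its size is $\int_\Omega\mathfrak{c}\,d\nu$, and $\mathsf{fcov}(F,W)$ is the infimum of the sizes of fractional $F$-covers in $W$. (For $H$, identify $V(H)$ with $[v(H)]$.) Bottleneck graphon: let $x\in[0,1)$, $\chi_{\mathrm{cr}}\in(1,\infty)$ and $r=\lceil\chi_{\mathrm{cr}}\rceil$. A graphon $W:\Omega^2\to[0,1]$ is a bottleneck graphon with parameters $x$ and $\chi_{\mathrm{cr}}$ if there is a measurable partition $\Omega=\Omega_1\sqcup\dots\sqcup\Omega_r$ with $\nu(\Omega_r)=\frac{x(\chi_{\mathrm{cr}}+1-r)}{\chi_{\mathrm{cr}}}$ and $\nu(\Omega_1)=\dots=\nu(\Omega_{r-1})=\frac{\chi_{\mathrm{cr}}-x(\chi_{\mathrm{cr}}+1-r)}{\chi_{\mathrm{cr}}(r-1)}$, such that for each $1\le i<j\le r$, $W$ is $1$ almost everywhere on $\Omega_i\times\Omega_j$, and for each $1\le i\le r-1$, $W$ is $0$ almost everywhere on $\Omega_i\times\Omega_i$ (no condition on $\Omega_r\times\Omega_r$). *)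

(* Defs.v *)
From HB Require Import structures.
From mathcomp Require Import all_boot all_order all_algebra.
From mathcomp Require Import all_classical all_reals all_analysis.
From mathcomp Require Import ess_sup_inf.

Set Implicit Arguments.
Unset Strict Implicit.
Unset Printing Implicit Defensive.

Import Order.TTheory GRing.Theory Num.Theory.
Import numFieldNormedType.Exports.

Local Open Scope classical_set_scope.
Local Open Scope ring_scope.

Record sgraph (V : finType) := SGraph {
  edge :> rel V;
  edge_sym : symmetric edge;
  edge_irrefl : irreflexive edge }.

Section Graphs.
Variables (V : finType) (G : sgraph V).

Definition proper_coloring (n : nat) (f : {ffun V -> 'I_n}) : bool :=
  [forall u, forall v, G u v ==> (f u != f v)].

Definition colorable (n : nat) : bool :=
  [exists f : {ffun V -> 'I_n}, proper_coloring f].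

Lemma colorable_card : exists n, colorable n.
Proof.
exists #|V|; apply/existsP; exists [ffun v => enum_rank v].
apply/forallP => u; apply/forallP => v; apply/implyP => uv.
rewrite !ffunE; apply: contraTneq uv => /enum_rank_inj ->.
by rewrite edge_irrefl.
Qed.

Definition chromatic_number : nat := ex_minn colorable_card.

(* The minimum is over all colour classes of all proper colourings with
   [chromatic_number] colours; the default value #|V| of the iterated minimum
   is an upper bound for the size of every colour class. *)
Definition smallest_color_class : nat :=
  \big[minn/#|V|]_(f : {ffun V -> 'I_chromatic_number} | proper_coloring f)
    \big[minn/#|V|]_(i < chromatic_number) #|[set v | f v == i]%SET|.

Definition critical_chromatic_number (R : realType) : R :=
  (chromatic_number%:R - 1) * #|V|%:R / (#|V|%:R - smallest_color_class%:R).

(* The identification of V with {0, ..., #|V| - 1}. *)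
Definition ord_edge : rel 'I_#|V| := fun i j => G (enum_val i) (enum_val j).

Lemma ord_edge_sym : symmetric ord_edge.
Proof. by move=> i j; exact: edge_sym. Qed.

Lemma ord_edge_irrefl : irreflexive ord_edge.
Proof. by move=> i; exact: edge_irrefl. Qed.

Definition ord_graph : sgraph 'I_#|V| := SGraph ord_edge_sym ord_edge_irrefl.

End Graphs.

(* T is isomorphic, as a measurable space, to a Polish space with its Borel
   sigma-algebra.  As f is bijective, every subset of T is of the form
   f @^-1` A, so that the last clause describes all measurable sets of T. *)
Definition standard_borel (R : realType) (d : measure_display)
    (T : measurableType d) : Prop :=
  exists (P : completePseudoMetricType R) (f : T -> P),
    [/\ hausdorff_space P, @second_countable P, bijective f &
        forall A : set P, <<s [set U : set P | open U] >> A <->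
                          measurable (f @^-1` A)].

Definition atomless (R : realType) (d : measure_display)
    (T : measurableType d) (nu : probability T R) : Prop :=
  forall A : set T, measurable A -> (0 < nu A)%E ->
    exists B : set T,
      [/\ measurable B, B `<=` A, (0 < nu B)%E & (nu B < nu A)%E].

Section PowerMeasure.
Context (R : realType) (d : measure_display) (T : measurableType d).
Variable nu : probability T R.

Definition tuple_cons (k : nat) (p : T * k.-tuple T) : k.+1.-tuple T :=
  [tuple of p.1 :: p.2].

Lemma measurable_tuple_cons (k : nat) :
  measurable_fun [set: T * k.-tuple T] (@tuple_cons k).
Proof. exact: measurable_cons. Qed.

HB.instance Definition _ (k : nat) :=
  isMeasurableFun.Build _ _ _ _ (@tuple_cons k) (@measurable_tuple_cons k).

(* The k-fold product measure on k.-tuple T, whose sigma-algebra is the product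
   one: the image of nu \x nu^(k-1) under (x, t) |-> x :: t. *)
Fixpoint power_measure (k : nat) : probability (k.-tuple T) R :=
  match k with
  | 0 => \d_[tuple]
  | k'.+1 => distribution (nu \x power_measure k')%E (@tuple_cons k')
  end.

Lemma power_measure_box (k : nat) (A : 'I_k -> set T) :
  (forall i, measurable (A i)) ->
  power_measure k [set x | forall i, A i (tnth x i)] =
  (\prod_(i < k) nu (A i))%E.
Proof.
elim: k A => [|k IH] A mA.
  rewrite big_ord0 /= diracE mem_set//=.
  by case.
rewrite big_ord_recl /= /distribution /pushforward /=.
rewrite -(IH (fun i => A (lift ord0 i)))//.
rewrite (_ : _ @^-1` _ =
  A ord0 `*` [set x | forall i, A (lift ord0 i) (tnth x i)]); last first.
  apply/seteqP; split => -[x t] /=.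
    by move=> h; split=> [|i]; [exact: (h ord0)|have := h (lift ord0 i); rewrite tnthS].
  by move=> [x0 xS] i; case: (unliftP ord0 i) => [j|] ->; rewrite ?tnthS.
rewrite product_measure1E//.
rewrite (_ : [set x | _] = \bigcap_(i in [set: 'I_k])
  ((fun x : k.-tuple T => tnth x i) @^-1` A (lift ord0 i))); last first.
  by apply/seteqP; split => [x h i _ /=|x h i]; [exact: h|exact: (h i)].
apply: fin_bigcap_measurable => // i _.
by rewrite -[X in measurable X]setTI; exact: measurable_tnth.
Qed.

End PowerMeasure.

Section Graphons.
Context (R : realType) (d : measure_display) (T : measurableType d).
Variable nu : probability T R.
Implicit Types W : T * T -> R.

Definition graphon W : Prop :=
  [/\ measurable_fun [set: T * T] W,
      forall x y, W (x, y) = W (y, x) &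
      forall z, 0 <= W z <= 1].

Definition degree W (x : T) : \bar R := (\int[nu]_y (W (x, y))%:E)%E.

Definition min_degree W : \bar R := ess_inf nu (degree W).

Definition supp (U : Type) (f : U -> R) : set U := [set x | f x != 0].

Definition tensor (k : nat) (F : sgraph 'I_k) W (x : k.-tuple T) : R :=
  \prod_(i < k) \prod_(j < k | (i < j)%N && F i j) W (tnth x i, tnth x j).

Definition fractional_cover (k : nat) (F : sgraph 'I_k) W (c : T -> R) : Prop :=
  [/\ measurable_fun [set: T] c,
      forall x, 0 <= c x <= 1 &
      power_measure nu k
        (supp (tensor F W) `&` [set x | \sum_(i < k) c (tnth x i) < 1]) = 0%E].

Definition fcov (k : nat) (F : sgraph 'I_k) W : \bar R :=
  ereal_inf [set (\int[nu]_x (c x)%:E)%E | c in fractional_cover F W].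

(* The parts are indexed from 0, so that the exceptional part is P i with
   i.+1 = r. *)
Definition bottleneck_graphon W (x chicr : R) : Prop :=
  let r := `|Num.ceil chicr|%N in
  let xr := x * (chicr + 1 - r%:R) in
  exists P : 'I_r -> set T,
    [/\ forall i, measurable (P i),
        trivIset [set: 'I_r] P &
        \bigcup_(i in [set: 'I_r]) P i = [set: T]] /\
    [/\ forall i : 'I_r, i.+1 = r -> nu (P i) = (xr / chicr)%:E,
        forall i : 'I_r, (i.+1 < r)%N ->
          nu (P i) = ((chicr - xr) / (chicr * (r%:R - 1)))%:E,
        forall i j : 'I_r, (i < j)%N ->
          {ae (nu \x nu)%E, forall z, (P i `*` P j) z -> W z = 1} &
        forall i : 'I_r, (i.+1 < r)%N ->
          {ae (nu \x nu)%E, forall z, (P i `*` P i) z -> W z = 0}].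

End Graphons.

(* Main.v *)
(* Let r = chi(H), h = v(H), l the size of a smallest colour class and p = x l / h;
   then almost every point has codegree at most beta = (1 - p) / (r - 1).

   Lower bound. Let q_j be the (j beta)-quantile of a cover c, for j < r. Greedily,
   vertices with c(x_j) < q_j + e form an r-clique with positive probability, and
   so does every blow-up of it; hence the q_j, distributed over the vertices of H
   along a colouring, sum to at least 1. Averaging over the cyclic rotations of
   the colours other than the smallest one bounds l q_{r-1} + (h - l) Q below by
   1, where Q is the mean of the other q_j, and integrating c by layers gives
   int c - x / h >= (1 - x) Q.

   Equality. The same estimates bound the mean distance of c to {0, 1 / l} by a
   multiple of int c - x / h. Applied to two covers and to their midpoint, this
   makes minimizing sequences Cauchy in L^1, so there is a minimal cover; it is
   {0, 1 / l}-valued. Its zero set Z has measure (r - 1) beta and contains no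
   r-clique, so the codegrees of an (r - 1)-clique in Z just suffice to cover Z;
   exchanging one vertex of the clique determines W on Z x Omega. *)

Require Import Defs.
From HB Require Import structures.
From mathcomp Require Import all_boot all_order all_algebra.
From mathcomp Require Import all_classical all_reals all_analysis.
From mathcomp Require Import perm zify ring lra measurable_realfun ess_sup_inf.

Set Implicit Arguments.
Unset Strict Implicit.
Unset Printing Implicit Defensive.
Import Order.TTheory GRing.Theory Num.Theory.
Import numFieldNormedType.Exports.

(** * Almost-everywhere quantifiers on product spaces *)

Section AeFubini.
Local Open Scope classical_set_scope.
Local Open Scope ereal_scope.
Context (R : realType) d1 d2 (X : measurableType d1) (Y : measurableType d2).
Variables (mu : probability X R) (nu : probability Y R).

Lemma ae_measurableP (A : set X) : measurable A ->
  (\forall x \ae mu, A x) <-> mu (~` A) = 0.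
Proof. by move=> mA; apply: negligibleP; exact: measurableC. Qed.

(** The whole space has measure 1 and so is not negligible; this is how a quantifier over a variable
    that no longer occurs gets dropped. *)
Lemma ae_const (P : Prop) : (\forall x \ae mu, P) <-> P.
Proof.
split=> [[N [mN N0 PN]]|p]; last exact: aeW.
apply: contrapT => np; have NT : N = setT by apply/seteqP; split=> // z _; exact: PN.
by move: N0; rewrite NT probability_setT => /eqP; rewrite onee_eq0.
Qed.

Lemma integral_ge0_eq0P (f : X -> \bar R) : measurable_fun [set: X] f ->
  (forall x, 0 <= f x) -> \int[mu]_x f x = 0 <-> \forall x \ae mu, f x = 0.
Proof.
move=> mf f0; have := ae_eq_integral_abs mu measurableT mf.
rewrite (_ : \int[mu]_x `|f x| = \int[mu]_x f x); last first.
  by apply: eq_integral => x _; rewrite gee0_abs.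
move=> -[H1 H2]; split=> [/H1|H]; first by apply: filterS => x; exact.
by apply: H2; apply: filterS H => x.
Qed.

(** The set is the zero set of the measurable map sending [x] to the measure of the section at [x]
    of the complement of [A]. *)
Lemma measurable_ae_section (A : set (X * Y)) : measurable A ->
  measurable [set x | \forall y \ae nu, A (x, y)].
Proof.
move=> mA.
have -> : [set x | \forall y \ae nu, A (x, y)] =
    (nu \o xsection (~` A)) @^-1` [set 0].
  apply/seteqP; split => x /=.
    move=> h; apply/negligibleP; first by apply: measurable_xsection; exact: measurableC.
    by apply: negligibleS h => y; rewrite /xsection/= inE.
  move=> h; exists (xsection (~` A) x); split => //.
    by apply: measurable_xsection; exact: measurableC.
  by move=> y /= h'; rewrite /xsection/= inE.
rewrite -[_ @^-1` _]setTI; apply: measurable_fun_xsection => //.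
exact: measurableC.
Qed.

Lemma ae_xsection (A : set (X * Y)) x : measurable A ->
  (\forall y \ae nu, A (x, y)) <-> nu (xsection (~` A) x) = 0.
Proof.
move=> mA; have mCA : measurable (~` A) by exact: measurableC.
rewrite -negligibleP; last exact: measurable_xsection.
by split; apply: negligibleS => y; rewrite /xsection/= inE.
Qed.

Lemma ae_ysection (A : set (X * Y)) y : measurable A ->
  (\forall x \ae mu, A (x, y)) <-> mu (ysection (~` A) y) = 0.
Proof.
move=> mA; have mCA : measurable (~` A) by exact: measurableC.
rewrite -negligibleP; last exact: measurable_ysection.
by split; apply: negligibleS => x; rewrite /ysection/= inE.
Qed.

End AeFubini.

Section AeFubiniSwap.
Local Open Scope classical_set_scope.
Local Open Scope ereal_scope.
Context (R : realType) d1 d2 (X : measurableType d1) (Y : measurableType d2).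
Variables (mu : probability X R) (nu : probability Y R).

Lemma ae_prod1P (A : set (X * Y)) : measurable A ->
  (\forall z \ae (mu \x nu)%E, A z) <->
  (\forall x \ae mu, \forall y \ae nu, A (x, y)).
Proof.
move=> mA; have mCA : measurable (~` A) by exact: measurableC.
transitivity ((mu \x nu) (~` A) = 0); first exact: negligibleP.
have := @integral_ge0_eq0P _ _ _ mu (nu \o xsection (~` A)).
rewrite -/(product_measure1 mu nu (~` A)) => ->//; last exact: measurable_fun_xsection.
by split; apply: filterS => x /(ae_xsection _ _ mA).
Qed.

(** Each side says that an iterated integral of the indicator of the complement vanishes; by Tonelli
    the two integrals are equal. *)
Lemma ae_swap (A : set (X * Y)) : measurable A ->
  (\forall x \ae mu, \forall y \ae nu, A (x, y)) <->
  (\forall y \ae nu, \forall x \ae mu, A (x, y)).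
Proof.
move=> mA; have mCA : measurable (~` A) by exact: measurableC.
have e1 := @integral_ge0_eq0P _ _ _ mu (nu \o xsection (~` A)).
have e2 := @integral_ge0_eq0P _ _ _ nu (mu \o ysection (~` A)).
have := indic_fubini_tonelli mu nu mCA.
rewrite indic_fubini_tonelli_FE// indic_fubini_tonelli_GE// => e.
transitivity (\forall x \ae mu, (nu \o xsection (~` A)) x = 0).
  by split; apply: filterS => x /(ae_xsection _ _ mA).
transitivity (\forall y \ae nu, (mu \o ysection (~` A)) y = 0); last first.
  by split; apply: filterS => x /(ae_ysection _ _ mA).
rewrite -e1//; last exact: measurable_fun_xsection.
by rewrite -e2 ?e//; exact: measurable_fun_ysection.
Qed.

End AeFubiniSwap.

(** * Resampling a coordinate *)

Section Resampling.
Local Open Scope classical_set_scope.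
Local Open Scope ereal_scope.

Lemma measurable_preimage d1 d2 (X : measurableType d1) (Y : measurableType d2)
    (f : X -> Y) (A : set Y) :
  measurable_fun [set: X] f -> measurable A -> measurable (f @^-1` A).
Proof. by move=> mf mA; rewrite -[X in measurable X]setTI; exact: mf. Qed.

Definition tset (T : Type) (k : nat) (c : 'I_k) (y : T) (x : k.-tuple T) :
  k.-tuple T := [tuple if i == c then y else tnth x i | i < k].

Context (R : realType) d (T : measurableType d).
Variable nu : probability T R.

Lemma measurable_fun_tset k (c : 'I_k) d' (X : measurableType d')
    (f : X -> T) (g : X -> k.-tuple T) :
  measurable_fun [set: X] f -> measurable_fun [set: X] g ->
  measurable_fun [set: X] (fun z => tset c (f z) (g z)).
Proof.
move=> mf mg; apply/measurable_fun_tnthP => i.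
have [->|ic] := eqVneq i c.
  rewrite (_ : _ \o _ = f)//; apply/funext => z /=.
  by rewrite tnth_mktuple eqxx.
rewrite (_ : _ \o _ = fun z => tnth (g z) i).
  exact: (measurableT_comp (measurable_tnth i)).
by apply/funext => z /=; rewrite tnth_mktuple (negbTE ic).
Qed.

Lemma tnth_tuple_cons0 k (p : T * k.-tuple T) : tnth (tuple_cons p) ord0 = p.1.
Proof. exact: tnth0. Qed.

Lemma tnth_tuple_consS k (p : T * k.-tuple T) i :
  tnth (tuple_cons p) (lift ord0 i) = tnth p.2 i.
Proof. exact: tnthS. Qed.

Lemma ae_power0 (Q : 0.-tuple T -> Prop) :
  (\forall x \ae power_measure nu 0, Q x) <-> Q [tuple].
Proof.
split=> [q|q]; last by apply: aeW => x; rewrite tuple0.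
apply/(ae_const (power_measure nu 0)).
by apply: filterS q => x; rewrite tuple0.
Qed.

Lemma ae_powerS k (Q : set (k.+1.-tuple T)) : measurable Q ->
  (\forall x \ae power_measure nu k.+1, Q x) <->
  (\forall t \ae nu, \forall x \ae power_measure nu k, Q (tuple_cons (t, x))).
Proof.
move=> mQ; have mc := @measurable_tuple_cons _ T k.
have mQ' : measurable (@tuple_cons _ T k @^-1` Q) by exact: measurable_preimage.
rewrite -(ae_prod1P nu (power_measure nu k) mQ').
by rewrite !ae_measurableP.
Qed.

Lemma ae_powerS_swap k (Q : set (k.+1.-tuple T)) : measurable Q ->
  (\forall x \ae power_measure nu k.+1, Q x) <->
  (\forall x \ae power_measure nu k, \forall t \ae nu, Q (tuple_cons (t, x))).
Proof.
move=> mQ; rewrite ae_powerS//.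
apply: (ae_swap nu (power_measure nu k) (A := @tuple_cons _ T k @^-1` Q)).
exact: (measurable_preimage (@measurable_tuple_cons _ T k)).
Qed.

Lemma measurable_consl k (t : T) : measurable_fun [set: k.-tuple T] (fun x => tuple_cons (t, x)).
Proof.
by apply: (measurableT_comp (@measurable_tuple_cons _ T k)); exact: measurable_fun_pair.
Qed.

(** Overwriting one coordinate by an independent point does not change the law of the tuple. The
    induction follows the recursion of [power_measure]: a coordinate in the tail is treated with the
    head fixed. *)
Lemma ae_resample k (c : 'I_k) (Q : set (k.-tuple T)) : measurable Q ->
  (\forall x \ae power_measure nu k, Q x) <->
  (\forall x \ae power_measure nu k, \forall y \ae nu, Q (tset c y x)).
Proof.
elim: k c Q => [[]//|k IH] c Q mQ.
have mR : measurable [set x | \forall y \ae nu, Q (tset c y x)].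
  apply: (measurable_ae_section nu (A := (fun z => tset c z.2 z.1) @^-1` Q)).
  by apply: measurable_preimage => //; exact: measurable_fun_tset.
rewrite [X in _ <-> X](@ae_powerS _ _ mR).
case: (unliftP ord0 c) mR => [j|] -> mR.
  rewrite ae_powerS//.
  have e t : (\forall x \ae power_measure nu k, Q (tuple_cons (t, x))) <->
    (\forall x \ae power_measure nu k,
       \forall y \ae nu, Q (tset (lift ord0 j) y (tuple_cons (t, x)))).
    rewrite (IH j ((fun x => tuple_cons (t, x)) @^-1` Q)); last first.
      by apply: measurable_preimage => //; exact: measurable_consl.
    have e x y : tuple_cons (t, tset j y x) = tset (lift ord0 j) y (tuple_cons (t, x)).
      apply: eq_from_tnth => i; rewrite tnth_mktuple.
      case: (unliftP ord0 i) => [i'|] ->; last by rewrite !tnth_tuple_cons0.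
      by rewrite !tnth_tuple_consS tnth_mktuple (inj_eq lift_inj).
    by split; apply: filterS => x; apply: filterS => y /=; rewrite e.
  by split; apply: filterS => t /e.
(* At the head, the new point replaces the old head [t]. After a swap the new point is chosen last,
   and the quantifier over [t] is idle. *)
rewrite ae_powerS_swap//.
have e t x : (\forall y \ae nu, Q (tuple_cons (y, x))) <->
    (\forall y \ae nu, Q (tset ord0 y (tuple_cons (t, x)))).
  have e y : (tuple_cons (y, x)) = tset ord0 y (tuple_cons (t, x)).
    apply: eq_from_tnth => i; rewrite tnth_mktuple.
    case: (unliftP ord0 i) => [i'|] ->; last by rewrite !tnth_tuple_cons0.
    by rewrite !tnth_tuple_consS.
  by split; apply: filterS => y; rewrite (e y).
split=> [h|h].
  by apply: aeW => t; apply: filterS h => x /(e t).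
apply/(ae_const nu); apply: filterS h => t; apply: filterS => x.
by move/e.
Qed.

Lemma tset_tset k (c : 'I_k) (y z : T) (x : k.-tuple T) : tset c y (tset c z x) = tset c y x.
Proof.
by apply: eq_from_tnth => i; rewrite !tnth_mktuple; case: (i == c).
Qed.

(* In almost every section along [c], two independent points are not both in
   [A], so the section is null. *)
Lemma ae_duplicate k (c : 'I_k) (A : set (k.-tuple T)) : measurable A ->
  (\forall x \ae power_measure nu k, \forall y \ae nu, ~ (A x /\ A (tset c y x))) ->
  \forall x \ae power_measure nu k, ~ A x.
Proof.
move=> mA h.
have [_ resampled] := ae_resample c (measurableC mA); apply: resampled.
have mR : measurable [set x | \forall y \ae nu, ~ (A x /\ A (tset c y x))].
  apply: (measurable_ae_section nu
    (A := ~` (fst @^-1` A `&` (fun z => tset c z.2 z.1) @^-1` A))).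
  apply: measurableC; apply: measurableI; apply: measurable_preimage => //.
  exact: measurable_fun_tset.
have [resampled _] := ae_resample c mR.
move: (resampled h); apply: filterS => x /= {}h.
have [[y Ay]|/forallNP n] := pselect (exists y, A (tset c y x) /\
    \forall z \ae nu, ~ (A (tset c y x) /\ A (tset c z (tset c y x)))).
  case: Ay => Ay; apply: filterS => z nA Az; apply: nA; split => //.
  by rewrite tset_tset.
by apply: filterS h => y hy Ay; apply: (n y).
Qed.

End Resampling.

(** * Blow-ups of cliques *)

Section Blowup.
Local Open Scope classical_set_scope.
Local Open Scope ring_scope.
Context (R : realType) d (T : measurableType d).
Variables (nu : probability T R) (W : T * T -> R).
Hypothesis W_graphon : graphon W.
Variables (r : nat) (D : 'I_r -> set T).
Hypothesis mD : forall p, measurable (D p).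

(** Adjacency means [0 < W]. For [g := id] these are the [r]-cliques whose vertex [p] lies in [D p];
    a general [g] replaces vertex [p] by the indices of colour [p], with no condition between
    indices of equal colour. *)
Definition blowup k (g : 'I_k -> 'I_r) : set (k.-tuple T) :=
  [set x | (forall i j, g i != g j -> 0 < W (tnth x i, tnth x j)) /\
           (forall i, D (g i) (tnth x i))].

Lemma measurable_forall_ord d' (X : measurableType d') k (P : 'I_k -> set X) :
  (forall i, measurable (P i)) -> measurable [set x | forall i, P i x].
Proof.
move=> mP; rewrite (_ : [set x | _] = \bigcap_(i in [set: 'I_k]) P i).
  exact: fin_bigcap_measurable.
by apply/seteqP; split => x h i => [_|]; exact: h.
Qed.

Lemma measurable_adj k (i j : 'I_k) :
  measurable [set x : k.-tuple T | 0 < W (tnth x i, tnth x j)].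
Proof.
have [mW _ _] := W_graphon.
have mf : measurable_fun [set: k.-tuple T] (fun x => W (tnth x i, tnth x j)).
  apply: (measurableT_comp mW); apply: measurable_fun_pair; exact: measurable_tnth.
rewrite (_ : [set x | _] =
    (fun x : k.-tuple T => W (tnth x i, tnth x j)) @^-1` [set` `]0, +oo[]).
  exact: measurable_preimage.
by apply/seteqP; split => x /=; rewrite in_itv/= andbT.
Qed.

Lemma measurable_blowup k (g : 'I_k -> 'I_r) : measurable (blowup g).
Proof.
apply: measurableI.
  apply: measurable_forall_ord => i; apply: measurable_forall_ord => j.
  have [e|ne] := eqVneq (g i) (g j).
    by rewrite [X in measurable X](_ : _ = setT)//; apply/seteqP; split.
  rewrite [X in measurable X](_ : _ = [set x | 0 < W (tnth x i, tnth x j)]).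
    exact: measurable_adj.
  by apply/seteqP; split => x /=; [exact|].
apply: measurable_forall_ord => i.
apply: (measurable_preimage (f := fun x => tnth x i)) => //.
exact: measurable_tnth.
Qed.

(** Two independent choices of vertex [c] in a blow-up along [g] form together a blow-up along [g'],
    since vertices of equal colour need not be adjacent. Then [ae_duplicate] applies. *)
Lemma blowup_duplicate k (g : 'I_k -> 'I_r) (g' : 'I_k.+1 -> 'I_r) (c : 'I_k) :
  g' ord0 = g c -> (forall i, g' (lift ord0 i) = g i) ->
  (\forall x \ae power_measure nu k.+1, ~ blowup g' x) ->
  \forall x \ae power_measure nu k, ~ blowup g x.
Proof.
move=> g'0 g'S h; have [_ W_sym _] := W_graphon.
apply: (ae_duplicate (c := c) (measurable_blowup g)).
have [+ _] := ae_powerS_swap nu (measurableC (measurable_blowup g')).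
move=> /(_ h); apply: filterS => x; apply: filterS => y nb [[xW xD] [yW yD]].
have yW' i : g i != g c -> 0 < W (y, tnth x i).
  move=> ic; have := yW c i; rewrite !tnth_mktuple eqxx eq_sym => /(_ ic).
  by case: eqVneq => // ec; rewrite ec eqxx in ic.
apply: nb; split=> i.
  move=> j; case: (unliftP ord0 i) => [i'|] ->; case: (unliftP ord0 j) => [j'|] ->;
    rewrite ?tnth_tuple_consS ?tnth_tuple_cons0 ?g'S ?g'0 //=.
  - exact: xW.
  - by rewrite W_sym; exact: yW'.
  - by rewrite eq_sym; exact: yW'.
  - by rewrite eqxx.
case: (unliftP ord0 i) => [i'|] ->;
  rewrite ?tnth_tuple_consS ?tnth_tuple_cons0 ?g'S ?g'0 //=.
by have := yD c; rewrite tnth_mktuple eqxx.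
Qed.

Definition ord_join h k (f : 'I_h -> 'I_r) (g : 'I_k -> 'I_r) (i : 'I_(h + k)) :=
  match fintype.split i with inl a => f a | inr b => g b end.

(** The vertices of [f] are removed one at a time, each being a duplicate of some vertex of [g];
    surjectivity of [g] provides the original. *)
Lemma blowup_join h k (f : 'I_h -> 'I_r) (g : 'I_k -> 'I_r) :
  (forall p, exists i, g i = p) ->
  (\forall x \ae power_measure nu (h + k), ~ blowup (ord_join f g) x) ->
  \forall x \ae power_measure nu k, ~ blowup g x.
Proof.
move=> g_onto; elim: h f => [|h IH] f H.
  suff -> : g = ord_join f g by [].
  apply/funext => i; rewrite /ord_join; case: splitP => [[]//|j ij].
  by congr g; apply/ord_inj.
apply: (IH (fun i : 'I_h => f (lift ord0 i))).
have [c gc] := g_onto (f ord0).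
have tail (i : 'I_(h + k)) :
    ord_join f g (lift ord0 i) = @ord_join h k (fun i : 'I_h => f (lift ord0 i)) g i.
  rewrite /ord_join; case: splitP => j; rewrite (@lift0 (h + k) i) => ej;
    case: splitP => j' ej'.
  - by congr f; apply/ord_inj; rewrite lift0 -ej' -ej.
  - by exfalso; move: (ltn_ord j) ej ej' => /=; lia.
  - by exfalso; move: (ltn_ord j') ej ej' => /=; lia.
  - by congr g; apply/ord_inj; move: ej ej' => /=; lia.
apply: (blowup_duplicate (c := rshift h c)) _ tail H.
rewrite {2}/ord_join; case: splitP => j /= ej.
  by have := ltn_ord j; rewrite -ej ltnNge leq_addr.
rewrite /ord_join; case: splitP => j' // ej'.
move/eqP: ej; rewrite eqn_add2l => /eqP /ord_inj <-; rewrite gc.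
by congr f; apply/ord_inj => /=; rewrite -ej'.
Qed.

Definition prefix_tuple h k (z : (h + k).-tuple T) : h.-tuple T :=
  [tuple tnth z (lshift k i) | i < h].

Lemma ae_prefix h k (Q : set (h.-tuple T)) : measurable Q ->
  (\forall y \ae power_measure nu h, Q y) ->
  \forall z \ae power_measure nu (h + k), Q (prefix_tuple z).
Proof.
elim: h Q => [|h IH] Q mQ.
  by move/ae_power0 => q; apply: aeW => z; rewrite tuple0.
have mp : measurable_fun [set: (h.+1 + k).-tuple T] (@prefix_tuple h.+1 k).
  apply/measurable_fun_tnthP => i.
  rewrite (_ : _ \o _ = fun z => tnth z (lshift k i)); first exact: measurable_tnth.
  by apply/funext => z /=; rewrite tnth_mktuple.
have [_ h2] := ae_powerS nu (measurable_preimage mp mQ).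
move=> /(ae_powerS nu mQ) h1; apply: h2.
apply: filterS h1 => t /(IH (fun y => Q (tuple_cons (t, y)))) h1.
have : measurable (fun y => Q (tuple_cons (t, y))).
  exact: measurable_preimage (measurable_consl t) mQ.
move=> /h1; apply: filterS => z /=.
suff -> : tuple_cons (t, prefix_tuple z) =
    prefix_tuple (tuple_cons (t, z) : (h.+1 + k).-tuple T) by [].
apply: eq_from_tnth => i; rewrite tnth_mktuple.
have -> : lshift k i = if unlift ord0 i is Some j then lift ord0 (lshift k j) else ord0.
  by apply/ord_inj; case: unliftP => [j|] ->.
case: (unliftP ord0 i) => [j|] ->; rewrite ?tnth_tuple_consS ?tnth_tuple_cons0 //=.
by rewrite tnth_mktuple.
Qed.

(** Joining [f] with [id] makes every colour available for duplication, even those that [f] omits. A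
    blow-up along the join restricts to one along [f], so it is null, and [blowup_join] descends to
    [id]. *)
Lemma ae_not_blowup h (f : 'I_h -> 'I_r) :
  (\forall y \ae power_measure nu h, ~ blowup f y) ->
  \forall x \ae power_measure nu r, ~ blowup id x.
Proof.
move=> H; apply: (blowup_join (f := f)); first by move=> p; exists p.
have := ae_prefix r (measurableC (measurable_blowup f)) H.
apply: filterS => z nb [zW zD]; apply: nb; split=> [i j|i]; rewrite !tnth_mktuple.
  move=> ij; apply: zW; move: ij; rewrite /ord_join.
  by rewrite !(unsplitK (inl _)).
by have := zD (lshift r i); rewrite /ord_join (unsplitK (inl i)).
Qed.

End Blowup.

(** * Bounded measurable functions *)

Section BoundedMeasurable.
Local Open Scope classical_set_scope.
Local Open Scope ring_scope.
Context (R : realType) d (T : measurableType d).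
Variable nu : probability T R.
Implicit Types (f g : T -> R) (A : set T).

(** This class is closed under the operations below and integrable for a probability, so that
    integrals can be computed in [R] instead of [\bar R]. *)
Definition bmeas f := measurable_fun [set: T] f /\ exists M : R, forall x, `|f x| <= M.

Lemma bmeas_cst (a : R) : bmeas (fun=> a).
Proof. by split; [exact: measurable_cst|exists `|a|]. Qed.

Lemma bmeasD f g : bmeas f -> bmeas g -> bmeas (fun x => f x + g x).
Proof.
move=> [mf [M fM]] [mg [N gN]]; split; first exact: measurable_funD.
by exists (M + N) => x; apply: le_trans (ler_normD _ _) (lerD _ _).
Qed.

Lemma bmeasZ (a : R) f : bmeas f -> bmeas (fun x => a * f x).
Proof.
move=> [mf [M fM]]; split; first by apply: measurable_funM => //; exact: measurable_cst.
by exists (`|a| * M) => x; rewrite normrM ler_wpM2l.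
Qed.

Lemma bmeasB f g : bmeas f -> bmeas g -> bmeas (fun x => f x - g x).
Proof.
move=> [mf [M fM]] [mg [N gN]]; split; first exact: measurable_funB.
by exists (M + N) => x; apply: le_trans (ler_normB _ _) (lerD _ _).
Qed.

Lemma bmeas_norm f : bmeas f -> bmeas (fun x => `|f x|).
Proof.
move=> [mf [M fM]]; split; first exact: measurableT_comp.
by exists M => x; rewrite normr_id.
Qed.

Lemma bmeas_min f g : bmeas f -> bmeas g -> bmeas (fun x => Num.min (f x) (g x)).
Proof.
move=> [mf [M fM]] [mg [N gN]]; split; first exact: measurable_minr.
exists (Num.max M N) => x.
by rewrite le_max; case: (leP (f x) (g x)) => _; rewrite ?fM ?gN ?orbT.
Qed.

Lemma bmeas_indic A : measurable A -> bmeas (\1_A : T -> R).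
Proof.
move=> mA; split; first exact: measurable_indic.
by exists 1 => x; rewrite indicE; case: (_ \in _); rewrite ?normr1 ?normr0.
Qed.

Lemma bmeas_sum (I : Type) (s : seq I) (F : I -> T -> R) :
  (forall i, bmeas (F i)) -> bmeas (fun x => \sum_(i <- s) F i x).
Proof.
move=> bF; elim: s => [|i s IH].
  by rewrite (_ : (fun _ => _) = fun=> 0); [exact: bmeas_cst|apply/funext => x; rewrite big_nil].
rewrite (_ : (fun _ => _) = fun x => F i x + \sum_(j <- s) F j x); first exact: bmeasD.
by apply/funext => x; rewrite big_cons.
Qed.

Lemma bmeas_integrable f : bmeas f -> nu.-integrable [set: T] (EFin \o f).
Proof.
move=> [mf [M fM]]; apply: measurable_bounded_integrable => //.
  by apply: (le_lt_trans (probability_le1 nu measurableT)); exact: ltry.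
exists M; split; first by rewrite num_real.
by move=> N MN x _; exact: le_trans (fM x) (ltW MN).
Qed.

Lemma bmeas_integralE f : bmeas f ->
  (\int[nu]_x (f x)%:E)%E = (\int[nu]_x f x)%:E.
Proof.
by move=> /bmeas_integrable bf; rewrite /Rintegral fineK//; exact: integrable_fin_num.
Qed.

Lemma mean_cst (a : R) : \int[nu]_x a = a.
Proof.
rewrite Rintegral_cst// [X in fine X](_ : _ = 1%E); first by rewrite mulr1.
exact: (probability_setT nu).
Qed.

Lemma meanD f g : bmeas f -> bmeas g ->
  \int[nu]_x (f x + g x) = \int[nu]_x f x + \int[nu]_x g x.
Proof. by move=> bf bg; rewrite RintegralD//; exact: bmeas_integrable. Qed.

Lemma meanB f g : bmeas f -> bmeas g ->
  \int[nu]_x (f x - g x) = \int[nu]_x f x - \int[nu]_x g x.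
Proof. by move=> bf bg; rewrite RintegralB//; exact: bmeas_integrable. Qed.

Lemma meanZ (a : R) f : bmeas f -> \int[nu]_x (a * f x) = a * \int[nu]_x f x.
Proof. by move=> bf; rewrite RintegralZl//; exact: bmeas_integrable. Qed.

Lemma mean_sum (I : Type) (s : seq I) (F : I -> T -> R) :
  (forall i, bmeas (F i)) ->
  \int[nu]_x (\sum_(i <- s) F i x) = \sum_(i <- s) \int[nu]_x F i x.
Proof.
move=> bF; elim: s => [|i s IH].
  by rewrite big_nil (@eq_Rintegral _ _ _ nu _ (cst 0)) ?mean_cst// => x _; rewrite big_nil.
rewrite big_cons -IH -meanD//; last exact: bmeas_sum.
by apply: eq_Rintegral => x _; rewrite big_cons.
Qed.

Lemma mean_indic A : measurable A -> \int[nu]_x (\1_A x : R) = fine (nu A).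
Proof. by move=> mA; rewrite /Rintegral integral_indic// setIT. Qed.

Lemma mean_ge0 f : bmeas f -> (\forall x \ae nu, 0 <= f x) -> 0 <= \int[nu]_x f x.
Proof.
move=> bf f0; rewrite (_ : Rintegral _ _ _ = \int[nu]_x `|f x|); first exact: Rintegral_ge0.
rewrite /Rintegral; congr fine; apply: ae_eq_integral => //.
- by apply/measurable_EFinP; case: bf.
- by apply/measurable_EFinP; case: (bmeas_norm bf).
- by apply: filterS f0 => x f0 _; rewrite ger0_norm.
Qed.

Lemma le_mean f g : bmeas f -> bmeas g -> (\forall x \ae nu, f x <= g x) ->
  \int[nu]_x f x <= \int[nu]_x g x.
Proof.
move=> bf bg fg; rewrite -subr_ge0 -meanB//; apply: mean_ge0; first exact: bmeasB.
by apply: filterS fg => x; rewrite subr_ge0.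
Qed.

Lemma mean_eq0 f : bmeas f -> (\forall x \ae nu, 0 <= f x) ->
  \int[nu]_x f x <= 0 -> \forall x \ae nu, f x = 0.
Proof.
move=> bf f0 i0; have bn := bmeas_norm bf.
have := ae_eq_integral_abs nu measurableT (f := EFin \o f).
have mf : measurable_fun [set: T] (EFin \o f) by apply/measurable_EFinP; case: bf.
case=> // + _; rewrite /comp/= (bmeas_integralE bn) => H.
suff /H : (\int[nu]_x `|f x|)%:E = 0 by apply: filterS => x /(_ Logic.I)[].
congr EFin; apply/eqP; rewrite eq_le Rintegral_ge0 ?andbT//.
apply: le_trans i0; apply: le_mean => //.
by apply: filterS f0 => x x0; rewrite ger0_norm.
Qed.

Lemma prob_fineK A : measurable A -> (fine (nu A))%:E = nu A.
Proof. by move=> mA; rewrite fineK// fin_num_measure. Qed.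

End BoundedMeasurable.

(** * Cliques from codegrees, quantiles *)

Section Cliques.
Local Open Scope classical_set_scope.
Local Open Scope ring_scope.
Context (R : realType) d (T : measurableType d).
Variables (nu : probability T R) (W : T * T -> R).
Hypothesis W_graphon : graphon W.

Lemma measurable_lt (f : T -> R) (b : R) : measurable_fun [set: T] f ->
  measurable [set x | f x < b].
Proof.
move=> mf; rewrite (_ : [set x | _] = f @^-1` [set` `]-oo, b[]).
  exact: measurable_preimage.
by apply/seteqP; split => x /=; rewrite in_itv.
Qed.

Lemma measurable_uncovered k (F : sgraph 'I_k) (c : T -> R) :
  measurable_fun [set: T] c ->
  measurable (supp (tensor F W) `&` [set x | \sum_(i < k) c (tnth x i) < 1]).
Proof.
move=> mc; have [mW _ W01] := W_graphon.
have msum (s : seq 'I_k) (g : 'I_k -> k.-tuple T -> R) :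
    (forall i, measurable_fun [set: k.-tuple T] (g i)) ->
    measurable_fun [set: k.-tuple T] (fun x => \sum_(i <- s) g i x).
  move=> mg; elim: s => [|i s IH].
    by under eq_fun do rewrite big_nil; exact: measurable_cst.
  by under eq_fun do rewrite big_cons; exact: measurable_funD.
have mprod (s : seq 'I_k) (P : pred 'I_k) (g : 'I_k -> k.-tuple T -> R) :
    (forall i, measurable_fun [set: k.-tuple T] (g i)) ->
    measurable_fun [set: k.-tuple T] (fun x => \prod_(i <- s | P i) g i x).
  move=> mg; elim: s => [|i s IH].
    by under eq_fun do rewrite big_nil; exact: measurable_cst.
  case Pi : (P i); under eq_fun do rewrite big_cons Pi; last exact: IH.
  exact: measurable_funM.
apply: measurableI.
  have mt : measurable_fun [set: k.-tuple T] (tensor F W).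
    apply: (mprod _ predT) => i; apply: mprod => j.
    apply: (measurableT_comp mW); apply: measurable_fun_pair; exact: measurable_tnth.
  rewrite (_ : supp _ = ~` (tensor F W @^-1` [set 0])).
    by apply: measurableC; exact: measurable_preimage.
  by apply/seteqP; split => x /= /eqP.
have ms : measurable_fun [set: k.-tuple T] (fun x => \sum_(i < k) c (tnth x i)).
  by apply: msum => i; apply: (measurableT_comp mc); exact: measurable_tnth.
rewrite (_ : [set x | _] =
    (fun x : k.-tuple T => \sum_(i < k) c (tnth x i)) @^-1` [set` `]-oo, 1[]).
  exact: measurable_preimage.
by apply/seteqP; split => x /=; rewrite in_itv.
Qed.

(** Otherwise the blow-ups along [f] would have positive measure. As [f] is proper, each of them is
    a copy of [F], and its weight under [c] is less than the sum of the [b (f i)], hence less than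
    1. *)
Lemma cover_no_clique k (F : sgraph 'I_k) (c : T -> R) r (b : 'I_r -> R)
    (f : 'I_k -> 'I_r) : (0 < k)%N ->
  fractional_cover nu F W c -> (forall i j, F i j -> f i != f j) ->
  \sum_(i < k) b (f i) <= 1 ->
  \forall x \ae power_measure nu r, ~ blowup W (fun p => [set y | c y < b p]) id x.
Proof.
move=> k0 [mc c01 cF] fF b1; have [mW _ W01] := W_graphon.
have mD p : measurable [set y | c y < b p] by exact: measurable_lt.
apply: (ae_not_blowup W_graphon mD (f := f)).
have mN := measurable_uncovered F mc.
exists (supp (tensor F W) `&` [set x | \sum_(i < k) c (tnth x i) < 1]); split => //.
move=> x /= /contrapT [xW xD]; split.
  rewrite /supp/= /tensor; apply/prodf_neq0 => i _; apply/prodf_neq0 => j /andP[_ ij].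
  by rewrite gt_eqF//; apply: xW; exact: fF.
apply: lt_le_trans b1; apply: ltr_sum; last by move=> i _; exact: xD.
by apply/hasP; exists (Ordinal k0); rewrite ?mem_index_enum.
Qed.

Lemma bmeas_graphon x : bmeas (fun y => W (x, y)).
Proof.
have [mW _ W01] := W_graphon; split.
  by apply: (measurableT_comp mW); exact: measurable_fun_pair.
by exists 1 => y; have /andP[w0 w1] := W01 (x, y); rewrite ger0_norm.
Qed.

Definition codegree (x : T) : R := \int[nu]_y (1 - W (x, y)).

Lemma bmeas_cographon x : bmeas (fun y => 1 - W (x, y)).
Proof. by apply: bmeasB; [exact: bmeas_cst|exact: bmeas_graphon]. Qed.

(** A union bound: almost every [t] in [D] has [W (tnth x i, t) = 0] for some [i], so the indicator
    of [D] is at most the sum of the [1 - W (tnth x i, t)]. *)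
Lemma uncovered_le k (x : k.-tuple T) (D : set T) (beta : R) : measurable D ->
  (forall i, codegree (tnth x i) <= beta) ->
  (\forall t \ae nu, ~ (D t /\ forall i, 0 < W (tnth x i, t))) ->
  fine (nu D) <= \sum_(i < k) codegree (tnth x i) /\
  \sum_(i < k) codegree (tnth x i) <= k%:R * beta.
Proof.
move=> mD xb h; have [mW _ W01] := W_graphon; split; last first.
  apply: le_trans (ler_sum _ (fun i _ => xb i)) _.
  by rewrite sumr_const card_ord mulr_natl.
have bs : forall i : 'I_k, bmeas (fun t => 1 - W (tnth x i, t))
  by move=> i; exact: bmeas_cographon.
rewrite -(mean_indic nu mD) -mean_sum//; apply: le_mean.
- exact: bmeas_indic.
- exact: bmeas_sum.
apply: filterS h => t nD.
have s0 : 0 <= \sum_(i < k) (1 - W (tnth x i, t)).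
  by apply: sumr_ge0 => i _; rewrite subr_ge0; case/andP: (W01 (tnth x i, t)).
rewrite indicE; case: (boolP (t \in D)) => [|_]//; rewrite inE => Dt.
have [i] : exists i, W (tnth x i, t) <= 0.
  apply: contrapT => /forallNP nW; apply: nD; split => // i.
  by rewrite ltNge; apply/negP; exact: nW.
move=> Wi; rewrite (bigD1 i)//= -[X in X <= _]addr0 lerD//; first by lra.
by apply: sumr_ge0 => j _; rewrite subr_ge0; case/andP: (W01 (tnth x j, t)).
Qed.

Lemma ae_tnth k (Q : T -> Prop) : (\forall t \ae nu, Q t) ->
  \forall x \ae power_measure nu k, forall i, Q (tnth x i).
Proof.
move=> [N [mN N0 QN]]; suff : \forall x \ae power_measure nu k, forall i, ~ N (tnth x i).
  by apply: filterS => x h i; apply: contrapT => q; exact: (h i (QN _ q)).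
have mA j : measurable [set x : j.-tuple T | forall i, ~ N (tnth x i)].
  apply: measurable_forall_ord => i.
  apply: (measurable_preimage (f := fun x => tnth x i) (A := ~` N)).
    exact: measurable_tnth.
  exact: measurableC.
elim: k => [|k IH]; first by apply: aeW => x [].
apply/(ae_powerS nu (mA k.+1)).
have : \forall t \ae nu, ~ N t.
  by exists N; split => // t /= /contrapT.
apply: filterS => t Nt; apply: filterS IH => x Nx i.
by case: (unliftP ord0 i) => [j|] ->; rewrite ?tnth_tuple_consS ?tnth_tuple_cons0.
Qed.

(* The head of a tuple is chosen last: it has to be adjacent to all the others. *)
Lemma clique_exists (beta : R) k (D : 'I_k -> set T) :
  (\forall x \ae nu, codegree x <= beta) ->
  (forall i, measurable (D i)) ->
  (forall i : 'I_k, (k - i.+1)%:R * beta < fine (nu (D i))) ->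
  ~ \forall x \ae power_measure nu k, ~ blowup W D id x.
Proof.
move=> Wb; have [_ W_sym _] := W_graphon.
elim: k D => [|k IH] D mD Db.
  move=> /ae_power0; apply; split=> -[] //.
have mB := measurable_blowup W_graphon mD id.
move=> /(ae_powerS_swap nu (measurableC mB)) h.
apply: (IH (fun i => D (lift ord0 i))) => // [i|].
  by have := Db (lift ord0 i); rewrite lift0.
have := ae_tnth k Wb; apply: filterS2 h => x h xb [xW xD].
have := Db ord0; rewrite subSS subn0 ltNge => /negP; apply.
have [] := @uncovered_le k x (D ord0) beta (mD _) xb; last exact: le_trans.
apply: filterS h => t nb [Dt tW]; apply: nb; split=> i.
  move=> j; case: (unliftP ord0 i) => [i'|] ->; case: (unliftP ord0 j) => [j'|] ->;
    rewrite ?tnth_tuple_consS ?tnth_tuple_cons0 ?eqxx//=.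
  - by move=> ij; apply: xW; move: ij; rewrite (inj_eq lift_inj).
  - by rewrite W_sym.
by case: (unliftP ord0 i) => [i'|] ->; rewrite ?tnth_tuple_consS ?tnth_tuple_cons0//=; exact: xD.
Qed.

(** The witness is the supremum of all [a] with [nu {c < a} <= t], a set bounded by 1 because
    [t < 1]. The supremum itself belongs to it by continuity of [nu] along increasing unions. *)
Lemma quantile (c : T -> R) (t : R) : measurable_fun [set: T] c ->
  (forall x, 0 <= c x <= 1) -> 0 <= t < 1 ->
  exists2 a, 0 <= a & fine (nu [set x | c x < a]) <= t /\
    forall b, a < b -> t < fine (nu [set x | c x < b]).
Proof.
move=> mc c01 /andP[t0 t1].
have mL b := measurable_lt b mc.
have mono a b : a <= b -> fine (nu [set x | c x < a]) <= fine (nu [set x | c x < b]).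
  move=> ab; rewrite fine_le ?fin_num_measure// le_measure ?inE// => x /= ca.
  exact: lt_le_trans ab.
pose S := [set a | fine (nu [set x | c x < a]) <= t].
have S0 : S 0.
  rewrite /S/= (_ : [set x | _] = set0) ?measure0//.
  by apply/seteqP; split => x //=; case/andP: (c01 x) => /le_gtF ->.
have S1 a : S a -> a <= 1.
  rewrite leNgt /S/= => Sa; apply/negP => a1; move: Sa.
  rewrite (_ : [set x | _] = setT) ?probability_setT/= ?leNgt ?t1//.
  by apply/seteqP; split => x //= _; apply: le_lt_trans a1; case/andP: (c01 x).
have supS : has_sup S by split; [exists 0|exists 1 => a /S1].
have Sub : forall a, S a -> a <= sup S by move=> a Sa; exact: (ub_le_sup supS.2).
exists (sup S); first exact: Sub.
split; last first.
  by move=> b; rewrite !ltNge; apply: contra => Sb; exact: Sub.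
pose G n := [set x | c x < sup S - n.+1%:R^-1].
have mG n : measurable (G n) by exact: mL.
have GU : \bigcup_n G n = [set x | c x < sup S].
  apply/seteqP; split => x; rewrite /G/=.
    by move=> [n _ /=] /lt_trans; apply; rewrite gtrBl invr_gt0.
  rewrite -subr_gt0 => xs; have [n _ hn] := near_infty_natSinv_lt (PosNum xs).
  exists n => //=; have := hn n (leqnn n); rewrite /=; set u := _^-1; lra.
have Gle n : (nu (G n) <= t%:E)%E.
  have [a Sa na] : exists2 a, S a & sup S - n.+1%:R^-1 < a.
    by apply: sup_adherent; rewrite ?invr_gt0.
  rewrite -(prob_fineK nu (mG n)) lee_fin; apply: le_trans Sa; apply: mono; exact: ltW.
have cvgG : nu (G n) @[n --> \oo] --> nu (\bigcup_n G n).
  apply: nondecreasing_cvg_mu => //; first exact: bigcupT_measurable.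
  move=> m n mn; apply/subsetPset => x; rewrite /G/= => /lt_le_trans; apply.
  by rewrite lerB// lef_pV2 ?posrE// ler_nat.
rewrite -lee_fin (prob_fineK nu (mL _)) -GU.
rewrite -(cvg_lim _ cvgG)//; apply: lime_le; first by apply/cvg_ex; eexists; exact: cvgG.
exact: nearW.
Qed.

End Cliques.

(** * Averaging over colourings *)

Section Averaging.
Local Open Scope ring_scope.

(** Addition in ['I_n.+1] is modulo [n.+1]: colour [ord0] stays fixed and the other colours are
    rotated by [s]. *)
Definition rotate_color n (s : 'I_n.+1) (i : 'I_n.+2) : 'I_n.+2 :=
  if unlift ord0 i is Some j then lift ord0 (j + s) else ord0.

Lemma rotate_color_inj n (s : 'I_n.+1) : injective (rotate_color s).
Proof.
move=> i j; rewrite /rotate_color.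
case: (unliftP ord0 i) => [i'|] ->; case: (unliftP ord0 j) => [j'|] -> //.
by move=> /lift_inj /addIr ->.
Qed.

(** The hypothesis is summed over all rotations of [f]. A vertex of colour [ord0] contributes
    [a ord0] each time; any other vertex runs once through all the remaining colours. *)
Lemma average_colorings (R : realType) n h (F : sgraph 'I_h)
    (f : 'I_h -> 'I_n.+2) (a : 'I_n.+2 -> R) :
  (forall i j, F i j -> f i != f j) ->
  (forall g : 'I_h -> 'I_n.+2, (forall i j, F i j -> g i != g j) ->
     1 <= \sum_i a (g i)) ->
  let l := #|[set i | f i == ord0]%SET| in
  n.+1%:R <= n.+1%:R * l%:R * a ord0 +
    (h%:R - l%:R) * \sum_j a (lift ord0 j).
Proof.
move=> fF aF /=; set l := #|_|; set S := \sum_j _.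
have H : n.+1%:R <= \sum_(s : 'I_n.+1) \sum_i a (rotate_color s (f i)).
  rewrite -[X in X%:R]card_ord -sumr_const; apply: ler_sum => s _.
  by apply: aF => i j ij; rewrite (inj_eq (@rotate_color_inj _ s)) fF.
apply: le_trans H _; rewrite exchange_big/=.
have e i : \sum_s a (rotate_color s (f i)) =
    S + (if f i == ord0 then n.+1%:R * a ord0 - S else 0).
  rewrite /rotate_color; case: (unliftP ord0 (f i)) => [j|] ->.
    rewrite eq_sym (negbTE (neq_lift _ _)) addr0 /S.
    by rewrite [RHS](reindex_inj (addrI j)).
  by rewrite eqxx sumr_const card_ord addrC subrK mulr_natl.
rewrite (eq_bigr _ (fun i _ => e i)) big_split/= sumr_const card_ord.
rewrite -big_mkcond/= sumr_const.
have -> : #|(fun i => f i == ord0)| = l by rewrite /l cardsE.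
rewrite -[S *+ h]mulr_natl -[(_ - S) *+ l]mulr_natl le_eqVlt.
by apply/orP; left; apply/eqP; ring.
Qed.

End Averaging.

(** * Limits of fractional covers *)

Section LimSup.
Local Open Scope classical_set_scope.
Local Open Scope ring_scope.
Context (R : realType).
Implicit Types u : nat -> R.

Lemma unit_bounded u : (forall n, 0 <= u n <= 1) ->
  [/\ bounded_fun u, has_ubound (range u) & has_lbound (range u)].
Proof.
move=> u01; have bu : bounded_fun u.
  exists 1; split; first by rewrite num_real.
  move=> M M1 n _ /=; have /andP[u0 u1] := u01 n.
  by rewrite ger0_norm// (le_trans u1)// ltW.
by split => //; [exact: bounded_fun_has_ubound|exact: bounded_fun_has_lbound].
Qed.

Lemma limn_sup_le u n b : (forall m, 0 <= u m <= 1) ->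
  (forall m, (n <= m)%N -> u m <= b) -> limn_sup u <= b.
Proof.
move=> /unit_bounded[bu ubu lbu] ub; rewrite (limn_supE bu).
apply: (@le_trans _ _ (sups u n)).
  by apply: ge_inf; [exact: bounded_fun_has_lbound_sups|exists n].
by apply: ge_sup; [exists (u n); exists n => /=|move=> _ [m /= nm <-]; exact: ub].
Qed.

Lemma limn_sup_lt u b : (forall m, 0 <= u m <= 1) -> limn_sup u < b ->
  exists n, forall m, (n <= m)%N -> u m < b.
Proof.
move=> /unit_bounded[bu ubu lbu]; rewrite (limn_supE bu) => /inf_lt.
case; first by exists (sups u 0%N); exists 0%N.
move=> _ [n _ <-] ltb; exists n => m nm; apply: le_lt_trans ltb.
by apply: ub_le_sup; [exact: has_ubound_sdrop|exists m].
Qed.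

Lemma limn_sup_ge0 u : (forall m, 0 <= u m <= 1) -> 0 <= limn_sup u.
Proof.
move=> u01; rewrite leNgt; apply/negP => /(limn_sup_lt u01)[n /(_ n (leqnn n))].
by apply/negP; rewrite -leNgt; case/andP: (u01 n).
Qed.

End LimSup.

Section CoverLimits.
Local Open Scope classical_set_scope.
Local Open Scope ring_scope.
Context (R : realType) d (T : measurableType d).
Variables (nu : probability T R) (W : T * T -> R).
Hypothesis W_graphon : graphon W.
Variables (h : nat) (F : sgraph 'I_h).

(** If the average of two sums is less than 1, one of the sums is; so the uncovered set lies in the
    union of two null sets. *)
Lemma midpoint_cover c c' : fractional_cover nu F W c ->
  fractional_cover nu F W c' ->
  fractional_cover nu F W (fun y => 2^-1 * (c y + c' y)).
Proof.
move=> [mc c01 cF] [mc' c01' cF'].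
have mm : measurable_fun [set: T] (fun y => 2^-1 * (c y + c' y)).
  by apply: measurable_funM; [exact: measurable_cst|exact: measurable_funD].
split=> [//|y|].
  by move: (c01 y) (c01' y); lra.
have mU := measurable_uncovered W_graphon F.
apply: (measure_negligible (mU _ mm)).
have /(negligibleP _ (mU _ mc)) n1 := cF.
have /(negligibleP _ (mU _ mc')) n2 := cF'.
apply: negligibleS (negligibleU n1 n2) => x [sx /=].
rewrite -mulr_sumr big_split/= => lt1.
have [lt|ge] := ltP (\sum_(i < h) c (tnth x i)) 1; first by left.
by right; split => //=; lra.
Qed.

(** A tuple uncovered by the limsup is uncovered by some [c_ k], so the uncovered set lies in a
    countable union of null sets. *)
Lemma limsup_cover (c_ : nat -> T -> R) :
  (forall k, fractional_cover nu F W (c_ k)) ->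
  fractional_cover nu F W (fun y => limn_sup (c_ ^~ y)).
Proof.
move=> cc; have c01 y k : 0 <= c_ k y <= 1 by case: (cc k).
have mc k : measurable_fun [set: T] (c_ k) by case: (cc k).
have mU := measurable_uncovered W_graphon F.
have ml : measurable_fun [set: T] (fun y => limn_sup (c_ ^~ y)).
  by apply: measurable_fun_limn_sup => // y _; case: (unit_bounded (c01 y)).
split=> [//|y|].
  rewrite limn_sup_ge0//=; apply: (limn_sup_le (n := 0)) => // m _.
  by case/andP: (c01 y m).
apply: (measure_negligible (mU _ ml)).
have H : (power_measure nu h).-negligible
    (\bigcup_k (supp (tensor F W) `&` [set x | \sum_(i < h) c_ k (tnth x i) < 1])).
  by apply: negligible_bigcup => k; apply/(negligibleP _ (mU _ (mc k))); case: (cc k).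
apply: negligibleS H => x [sx /= lt1].
set S := \sum_(i < h) _ in lt1.
have [h0|h0] := posnP h.
  exists 0%N => //; split => //=; rewrite big1 ?ltr01// => i.
  by have := ltn_ord i; rewrite [X in (_ < X)%N]h0.
(* The slack [1 - S] is divided equally among the [h] coordinates; from some index on, each [c_ m]
   exceeds the limsup by less than its share. *)
pose e := (1 - S) / h%:R.
have e0 : 0 < e by rewrite divr_gt0 ?subr_gt0// ltr0n.
have /choice[N NP] : forall i : 'I_h, exists n, forall m, (n <= m)%N ->
    c_ m (tnth x i) < limn_sup (c_ ^~ (tnth x i)) + e.
  by move=> i; apply: limn_sup_lt; rewrite ?ltrDl.
exists (\max_i N i)%N => //; split=> //=.
have -> : 1 = \sum_(i < h) (limn_sup (c_ ^~ (tnth x i)) + e).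
  rewrite big_split/= sumr_const card_ord -/S -mulr_natr /e divfK ?pnatr_eq0 -?lt0n//.
  by rewrite addrC subrK.
apply: ltr_sum; first by apply/hasP; exists (Ordinal h0); rewrite ?mem_index_enum.
by move=> i _; apply: NP; exact: leq_bigmax.
Qed.

(** Pointwise the limsup is at most [c_ n] plus the series of later increments, whose integral is
    bounded by a geometric tail. *)
Lemma mean_limsup_le (c_ : nat -> T -> R) (C : R) n :
  (forall k, measurable_fun [set: T] (c_ k)) -> (forall k y, 0 <= c_ k y <= 1) ->
  (forall k, \int[nu]_y `|c_ k.+1 y - c_ k y| <= C * 2^-1 ^+ k) ->
  \int[nu]_y limn_sup (c_ ^~ y) <= \int[nu]_y c_ n y + 2 * C * 2^-1 ^+ n.
Proof.
move=> mc c01 cC.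
have bc k : bmeas (c_ k).
  split=> //; exists 1 => y; case/andP: (c01 k y) => c0 c1.
  by rewrite ger0_norm.
have bd k : bmeas (fun y => `|c_ k.+1 y - c_ k y|) by apply: bmeas_norm; exact: bmeasB.
have bl : bmeas (fun y => limn_sup (c_ ^~ y)).
  split; first by apply: measurable_fun_limn_sup => // y _; case: (@unit_bounded _ (c_ ^~ y)).
  exists 1 => y; rewrite ger0_norm ?limn_sup_ge0//.
  by apply: (limn_sup_le (n := 0)) => // m _; case/andP: (c01 m y).
rewrite -lee_fin EFinD -!bmeas_integralE//.
pose G y : \bar R := (\sum_(k <oo) `|c_ (n + k).+1 y - c_ (n + k)%N y|%:E)%E.
have mG k : measurable_fun [set: T] (fun y => `|c_ (n + k).+1 y - c_ (n + k)%N y|%:E).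
  by apply/measurable_EFinP; case: (bd (n + k)%N).
have G0 y : (0 <= G y)%E by apply: nneseries_ge0.
have IG : (\int[nu]_y G y <= (2 * C * 2^-1 ^+ n)%:E)%E.
  rewrite integral_nneseries//; apply: lime_le.
    by apply: is_cvg_nneseries => k _ _; apply: integral_ge0.
  apply: nearW => N /=.
  under eq_bigr do rewrite (bmeas_integralE nu (bd _)).
  rewrite sumEFin lee_fin big_mkord.
  apply: (@le_trans _ _ (\sum_(k < N) C * 2^-1 ^+ (n + k)%N)).
    by apply: ler_sum => k _; exact: cC.
  have C0 : 0 <= C.
    by have := cC 0%N; rewrite expr0 mulr1; apply: le_trans; exact: Rintegral_ge0.
  have -> : \sum_(k < N) C * 2^-1 ^+ (n + k)%N = 2 * C * 2^-1 ^+ n - 2 * C * 2^-1 ^+ (n + N)%N.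
    elim: N => [|N IH]; first by rewrite big_ord0 addn0 subrr.
    rewrite big_ord_recr/= IH addnS exprS; set t := _ ^+ (n + N); lra.
  by rewrite gerBl mulr_ge0// ?mulr_ge0// exprn_ge0.
apply: le_trans (leeD (lexx _) IG).
have mGG : measurable_fun [set: T] G by apply: ge0_emeasurable_sum.
rewrite -ge0_integralD//; last 2 first.
- by move=> y _; rewrite lee_fin; case/andP: (c01 n y).
- exact/measurable_EFinP.
apply: ge0_le_integral => //.
- by move=> y _; rewrite lee_fin limn_sup_ge0.
- by apply/measurable_EFinP; case: bl.
- by apply: emeasurable_funD => //; exact/measurable_EFinP.
(* Where the series diverges the bound is trivial; elsewhere telescoping bounds every [c_ m] with
   [n <= m]. *)
move=> y _; have [->|Gfin] := eqVneq (G y) +oo%E; first by rewrite addey// leey.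
have /fineK GE : G y \is a fin_num by rewrite ge0_fin_numE// lt_neqAle Gfin leey.
rewrite -GE -EFinD lee_fin; apply: (limn_sup_le (n := n)) => // m /subnKC <-.
set N := (m - n)%N.
apply: (@le_trans _ _ (c_ n y + \sum_(k < N) `|c_ (n + k).+1 y - c_ (n + k)%N y|)).
  elim: N => [|N IH]; first by rewrite big_ord0 addr0 addn0.
  rewrite big_ord_recr/= addnS addrA -lerBlDr; apply: le_trans IH.
  by rewrite lerBlDr -lerBlDl ler_norm.
rewrite lerD2l -lee_fin GE -sumEFin.
have := @nneseries_lim_ge R (fun k => `|c_ (n + k).+1 y - c_ (n + k)%N y|%:E) xpredT 0 N.
by rewrite big_mkord; apply.
Qed.

End CoverLimits.

(** * Sizes of fractional covers *)

(* [t] is close to the two-point set {0, 1 / l} when [psi l t] is small. *)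
Definition psi (R : realType) (l : nat) (t : R) : R :=
  Num.min t `|t - l%:R^-1|%R.

Lemma bmeas_psi (R : realType) d (T : measurableType d) (l : nat) (c : T -> R) :
  bmeas c -> bmeas (fun y => psi l (c y)).
Proof.
by move=> bc; apply: bmeas_min => //; apply: bmeas_norm; apply: bmeasB => //; exact: bmeas_cst.
Qed.

Section CoverBounds.
Local Open Scope classical_set_scope.
Local Open Scope ring_scope.
Context (R : realType) d (T : measurableType d).
Variables (nu : probability T R) (W : T * T -> R).
Hypothesis W_graphon : graphon W.
Variables (n h : nat) (F : sgraph 'I_h) (f : 'I_h -> 'I_n.+2).
Hypothesis fF : forall i j, F i j -> f i != f j.
Let l := #|[set i | f i == ord0]%SET|.
Hypothesis l_gt0 : (0 < l)%N.
Hypothesis l_lt : (l < h)%N.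
Variable (x : R).
Hypothesis x01 : 0 <= x <= 1.
(** These are the measures of the parts of a bottleneck graphon: [p] for the exceptional part and
    [beta] for each of the other [n.+1]. *)
Let p : R := x * l%:R / h%:R.
Let beta : R := (1 - p) / n.+1%:R.
Hypothesis W_codegree : \forall t \ae nu, codegree nu W t <= beta.

Lemma l_bounds : (0 : R) < l%:R /\ (l%:R : R) < h%:R.
Proof. by rewrite ltr0n ltr_nat. Qed.

Lemma indic_nlt (c : T -> R) b y :
  \1_(~` [set y | c y < b]) y = ((b <= c y)%R)%:R :> R.
Proof.
rewrite indicE; congr (_%:R); congr nat_of_bool.
by apply/idP/idP; rewrite inE/= leNgt => /negP.
Qed.

Lemma p_lt1 : p < 1.
Proof.
case/andP: x01 => x0 x1; have [l0 lh] := l_bounds.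
rewrite /p ltr_pdivrMr ?(lt_trans l0)// mul1r.
by apply: le_lt_trans lh; rewrite ler_piMl ?(ltW l0).
Qed.

Lemma beta_gt0 : 0 < beta.
Proof. by rewrite divr_gt0// subr_gt0 p_lt1. Qed.

Lemma cover_bmeas c : fractional_cover nu F W c -> bmeas c.
Proof.
move=> [mc c01 _]; split=> //; exists 1 => y.
by case/andP: (c01 y) => c0 c1; rewrite ger0_norm.
Qed.

(** Here [q] is the quantile at level [1 - p], and [Q] is the sum of the lower ones, not yet their
    mean. *)
Lemma cover_quantiles c : fractional_cover nu F W c -> 0 < x ->
  exists q Q, [/\ 0 <= q, 0 <= Q,
    n.+1%:R <= n.+1%:R * l%:R * q + (h%:R - l%:R) * Q,
    beta * Q + p * q <= \int[nu]_y c y &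
    fine (nu [set y | c y < q]) <= 1 - p].
Proof.
move=> cc x0; have [mc c01 _] := cc; have bc := cover_bmeas cc.
have b0 := beta_gt0; have [l0 lh] := l_bounds.
have p0 : 0 < p by rewrite /p divr_gt0 ?mulr_gt0// (lt_trans l0).
have nb : n.+1%:R * beta = 1 - p by rewrite /beta mulrC divfK// pnatr_eq0.
(* For [j <= n.+1] the level [j * beta] is at most [1 - p], which is below 1 because [0 < x]. Larger
   [j] get the dummy value 0. *)
have /choice[q qP] : forall j : nat, exists a, (j <= n.+1)%N ->
    0 <= a /\ (fine (nu [set y | c y < a]) <= j%:R * beta /\
    forall b, a < b -> j%:R * beta < fine (nu [set y | c y < b])).
  move=> j; have [jn|jn] := leqP j n.+1; last by exists 0.
  have [|a a0 aP] := @quantile _ _ _ nu c (j%:R * beta) mc c01.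
    rewrite mulr_ge0 ?(ltW b0)//= (@le_lt_trans _ _ (n.+1%:R * beta))//.
      by rewrite ler_wpM2r ?(ltW b0)// ler_nat.
    by rewrite nb gtrBl.
  by exists a => _.
have q0 j : (j <= n.+1)%N -> 0 <= q j by case/qP.
(* In [clique_exists] vertex [i] is chosen after [n.+1 - i] others, so it needs a set of measure
   above [(n.+1 - i) * beta]. The smallest class, of colour [ord0], thus gets the highest
   quantile. *)
pose a (i : 'I_n.+2) := q (n.+1 - i)%N.
have aF (g : 'I_h -> 'I_n.+2) : (forall i j, F i j -> g i != g j) -> 1 <= \sum_i a (g i).
  move=> gF; rewrite leNgt; apply/negP => ag.
  (* Raising every threshold by [e] brings their total over the [h] vertices to exactly 1, and puts
     each strictly above its quantile. *)
  pose e := (1 - \sum_i a (g i)) / h%:R.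
  have e0 : 0 < e by rewrite divr_gt0 ?subr_gt0// (lt_trans l0).
  have h0 : (0 < h)%N by apply: leq_ltn_trans l_lt.
  have := @cover_no_clique _ _ _ nu W W_graphon h F c n.+2 (fun i => a i + e) g h0 cc gF.
  rewrite big_split/= sumr_const card_ord -mulr_natr /e divfK ?pnatr_eq0 -?lt0n//.
  rewrite addrC subrK => /(_ (lexx _)); apply: (clique_exists W_graphon W_codegree).
    by move=> i; exact: measurable_lt.
  move=> i; have [|_ [_]] := qP (n.+1 - i)%N; first exact: leq_subr.
  by rewrite subSS; apply; rewrite ltrDl.
exists (q n.+1), (\sum_(j < n.+1) q j); split.
- exact: q0.
- by apply: sumr_ge0 => j _; apply: q0; exact: ltnW.
- have := average_colorings fF aF; rewrite -/l.
  rewrite {1}/a subn0 (_ : \sum_j a (lift ord0 j) = \sum_(j < n.+1) q j)//.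
  rewrite [RHS](reindex_inj rev_ord_inj)/=; apply: eq_bigr => j _.
  by rewrite /a lift0 subSS.
(* Integration by layers: raising the truncation level from [q m] to [q m.+1] adds the increment
   times the measure of [{q m.+1 <= c}], which is at least [1 - m.+1 * beta]. The left side is the
   result of summation by parts. *)
- have claim m : (m <= n.+1)%N ->
      beta * (\sum_(j < m) q j) + (1 - m%:R * beta) * q m <=
      \int[nu]_y Num.min (c y) (q m).
    have bm j : bmeas (fun y => Num.min (c y) (q j)) by apply: bmeas_min => //; exact: bmeas_cst.
    have m_ge b : measurable (~` [set y | c y < b]) by apply: measurableC; exact: measurable_lt.
    have bi b : bmeas (\1_(~` [set y | c y < b]) : T -> R) by exact: bmeas_indic.
    have ge j : (j <= n.+1)%N -> 1 - j%:R * beta <= \int[nu]_y \1_(~` [set y | c y < q j]) y.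
      move=> /qP[_ [qj _]]; rewrite mean_indic// probability_setC; last exact: measurable_lt.
      rewrite -prob_fineK; last exact: measurable_lt.
      by rewrite /= lerB.
    elim: m => [|m IH] mn.
      rewrite big_ord0 mulr0 add0r mulrC; apply: le_trans (ler_wpM2l (q0 _ mn) (ge _ mn)) _.
      rewrite -meanZ//; apply: le_mean => //; first exact: bmeasZ.
      apply: aeW => y; rewrite indic_nlt; case/andP: (c01 y) => c0 _.
      by case: (leP (q 0%N) (c y)) => cy; rewrite ?mulr1 ?mulr0.
    have mn' := ltnW mn.
    have qmm : q m <= q m.+1.
      rewrite leNgt; apply/negP => qq; have [_ [_ /(_ _ qq)]] := qP _ mn.
      have [_ [qm _]] := qP _ mn'; move/lt_le_trans/(_ qm).
      by rewrite ltr_pM2r// ltr_nat ltnNge leqnSn.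
    have step : \int[nu]_y Num.min (c y) (q m) +
        (q m.+1 - q m) * (\int[nu]_y \1_(~` [set y | c y < q m.+1]) y) <=
        \int[nu]_y Num.min (c y) (q m.+1).
      rewrite -meanZ// -meanD//; last exact: bmeasZ.
      apply: le_mean => //; first by apply: bmeasD => //; exact: bmeasZ.
      apply: aeW => y; rewrite indic_nlt; case: (leP (q m.+1) (c y)) => cy.
        by rewrite mulr1 (min_idPr (le_trans qmm cy)) addrC subrK.
      by rewrite mulr0 addr0 ge_min lexx.
    apply: le_trans step; rewrite big_ord_recr/=.
    have qm0 : 0 <= q m.+1 - q m by rewrite subr_ge0.
    apply: le_trans (lerD (IH mn') (ler_wpM2l qm0 (ge _ mn))).
    by rewrite le_eqVlt -[m.+1]addn1 natrD; apply/orP; left; apply/eqP; ring.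
  have := claim n.+1 (leqnn _); rewrite nb subKr => cl.
  apply: le_trans cl _; apply: le_mean => //; first by apply: bmeas_min => //; exact: bmeas_cst.
  by apply: aeW => y; rewrite ge_min lexx.
- by have [_ []] := qP _ (leqnn n.+1); rewrite nb.
Qed.

(** Now [Q] is a mean. Since [p = (x / h) * l], multiplying the bound [1 <= l q + (h - l) Q] by
    [x / h] produces the term [p * q], which cancels against that in the bound on the integral. *)
Lemma cover_gap c : fractional_cover nu F W c -> 0 < x ->
  exists q Q, [/\ 0 <= q, 0 <= Q,
    1 <= l%:R * q + (h%:R - l%:R) * Q,
    (1 - x) * Q <= \int[nu]_y c y - x / h%:R &
    fine (nu [set y | c y < q]) <= 1 - p].
Proof.
move=> cc x0; have [q [Q [q0 Q0 qQ bQ nq]]] := cover_quantiles cc x0.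
have [l0 lh] := l_bounds; case/andP: x01 => _ x1.
have n0 : 0 < n.+1%:R :> R by rewrite ltr0n.
have h0 := lt_trans l0 lh.
have qQ' : 1 <= l%:R * q + (h%:R - l%:R) * (Q / n.+1%:R).
  have nQ : n.+1%:R * (Q / n.+1%:R) = Q by rewrite mulrC divfK// gt_eqF.
  rewrite -(ler_pM2l n0) mulr1; apply: le_trans qQ _; set u := Q / _ in nQ *.
  by rewrite -nQ le_eqVlt; apply/orP; left; apply/eqP; ring.
exists q, (Q / n.+1%:R); split => //; first by rewrite divr_ge0// ltW.
have xh : 0 <= x / h%:R by rewrite divr_ge0// ltW.
have := ler_wpM2l xh qQ'; move: bQ; rewrite /beta.
have -> : (1 - p) / n.+1%:R * Q = (1 - p) * (Q / n.+1%:R) by rewrite mulrAC mulrA.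
rewrite /p; set u := Q / _; set I := \int[nu]_y _.
have -> : x * l%:R / h%:R = x / h%:R * l%:R by rewrite mulrAC.
have xE : x / h%:R * h%:R = x by rewrite divfK// gt_eqF.
set v := x / h%:R in xE *; have xu : x * u = v * h%:R * u by rewrite xE.
by rewrite mulr1 => H1 H2; lra.
Qed.

Lemma cover_lower c : fractional_cover nu F W c -> x / h%:R <= \int[nu]_y c y.
Proof.
move=> cc; have bc := cover_bmeas cc; case/andP: x01 => + x1.
rewrite le_eqVlt => /predU1P[<-|x0].
  by rewrite mul0r; apply: mean_ge0 => //; apply: aeW => y; have [_ /(_ y)/andP[]] := cc.
have [q [Q [_ Q0 _ + _]]] := cover_gap cc x0.
move=> gap; rewrite -subr_ge0; apply: le_trans gap.
by rewrite mulr_ge0// subr_ge0.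
Qed.

(** A small gap makes [Q] small because [x < 1], so [q] is not much below [1 / l]; and [c] is at
    least [q] on a set of measure at least [p], which already accounts for nearly all of [x / h]. *)
Lemma cover_psi : x < 1 -> exists2 K : R, 0 <= K & forall c,
  fractional_cover nu F W c ->
  \int[nu]_y psi l (c y) <= K * (\int[nu]_y c y - x / h%:R).
Proof.
move=> x1; have [l0 lh] := l_bounds; have h0 := lt_trans l0 lh.
have y0 : 0 < 1 - x by rewrite subr_gt0.
(* The 1 pays for the gap itself. The rest pays for [(1 + p) (1 / l - th)], at most [2 (h / l) Q],
   where [Q] is at most the gap over [1 - x]. *)
pose K : R := 1 + 2 * h%:R / l%:R / (1 - x).
have K2 : 0 <= 2 * h%:R / l%:R / (1 - x) by rewrite !divr_ge0 ?mulr_ge0// ltW.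
exists K; first by rewrite addr_ge0.
move=> c cc; have bc := cover_bmeas cc; have [mc c01 _] := cc.
have low := cover_lower cc.
have psi_le : \int[nu]_y psi l (c y) <= \int[nu]_y c y.
  by apply: le_mean => //; [exact: bmeas_psi|apply: aeW => y; rewrite /psi ge_min lexx].
case/andP: (x01) => + _; rewrite le_eqVlt => /predU1P[x0|x0].
  apply: le_trans psi_le _; rewrite -x0 mul0r subr0 ler_peMl//.
    by move: low; rewrite -x0 mul0r.
  by rewrite /K lerDl -x0.
have [q [Q [q0 Q0 qQ gap nq]]] := cover_gap cc x0.
pose th := Num.min q l%:R^-1.
have mth : measurable (~` [set y | c y < th]) by apply: measurableC; exact: measurable_lt.
have nth : p <= \int[nu]_y \1_(~` [set y | c y < th]) y.
  rewrite mean_indic// probability_setC; last exact: measurable_lt.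
  rewrite -prob_fineK; last exact: measurable_lt.
  rewrite /= lerBrDr -lerBrDl; apply: le_trans nq.
  rewrite fine_le ?fin_num_measure//; try exact: measurable_lt.
  rewrite le_measure ?inE//; try exact: measurable_lt.
  by move=> y /= /lt_le_trans; apply; rewrite ge_min lexx.
have bi : bmeas (\1_(~` [set y | c y < th]) : T -> R) by exact: bmeas_indic.
have thl : th <= l%:R^-1 by rewrite ge_min lexx orbT.
have th0 : 0 <= th by rewrite le_min q0 invr_ge0 ltW.
(* Pointwise: where [th <= c], the distance from [c] to [1 / l] is at most
   [(c - th) + (1 / l - th)]; elsewhere [psi] is at most [c]. *)
have b1 : \int[nu]_y psi l (c y) <=
    \int[nu]_y c y - th * (\int[nu]_y \1_(~` [set y | c y < th]) y) + (l%:R^-1 - th).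
  rewrite -meanZ// -meanB//; last exact: bmeasZ.
  rewrite -[X in _ + X](mean_cst nu) -meanD//; last 2 first.
  - by apply: bmeasB => //; exact: bmeasZ.
  - exact: bmeas_cst.
  apply: le_mean; first exact: bmeas_psi.
    by apply: bmeasD; [apply: bmeasB => //; exact: bmeasZ|exact: bmeas_cst].
  apply: aeW => y; rewrite indic_nlt /psi; case: (leP th (c y)) => cy.
    rewrite mulr1 ge_min; apply/orP; right; rewrite ler_norml; apply/andP; split; lra.
  by rewrite mulr0 subr0 ge_min lerDl subr_ge0 thl.
apply: le_trans b1 _; have thp := ler_wpM2l th0 nth.
have e_le : l%:R^-1 - th <= h%:R / l%:R * Q.
  have L0 : 0 <= l%:R^-1 :> R by rewrite invr_ge0 ltW.
  have lL : l%:R^-1 * l%:R = 1 :> R by rewrite mulVf// gt_eqF.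
  rewrite /th; case: (leP q l%:R^-1) => ql; last first.
    by rewrite subrr mulr_ge0// divr_ge0// ltW.
  have := ler_wpM2l L0 qQ; set L := l%:R^-1 in lL L0 *.
  have e1 : L * l%:R * q = q by rewrite lL mul1r.
  by have e2 : L * l%:R * Q = Q; [rewrite lL mul1r|lra].
have px : p * l%:R^-1 = x / h%:R by rewrite /p mulrAC mulrK// unitfE gt_eqF.
have hlQ : 2 * (h%:R / l%:R * Q) <= 2 * h%:R / l%:R / (1 - x) * (\int[nu]_y c y - x / h%:R).
  have Qle : Q <= (\int[nu]_y c y - x / h%:R) / (1 - x) by rewrite ler_pdivlMr// mulrC.
  have hl0 : 0 <= 2 * (h%:R / l%:R) :> R by rewrite mulr_ge0// divr_ge0// ltW.
  by apply: le_trans (_ : _ <= _) (le_trans (ler_wpM2l hl0 Qle) _);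
    rewrite le_eqVlt; apply/orP; left; apply/eqP; ring.
have ep : (l%:R^-1 - th) * p <= l%:R^-1 - th.
  by rewrite ler_piMr ?subr_ge0// ltW// p_lt1.
rewrite /K mulrDl mul1r; move: ep; rewrite mulrBl [_ * p]mulrC px.
set I1 := \int[nu]_y c y in hlQ *; lra.
Qed.

(** If [s] and [t] are near different points of {0, 1 / l}, their midpoint is near [1 / (2 l)],
    where [psi] is large; if they are near the same point, they are close. *)
Lemma psi_dist (s t : R) : 0 <= s -> 0 <= t ->
  `|s - t| <= 2 * (psi l s + psi l t + psi l (2^-1 * (s + t))).
Proof.
have [l0 _] := l_bounds; have : 0 < l%:R^-1 :> R by rewrite invr_gt0.
rewrite /psi; set L := l%:R^-1 => L0 s0 t0.
case: (leP s); case: (leP t); case: (leP (2^-1 * (s + t)));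
  case: (ger0P (s - t)); case: (ger0P (s - L)); case: (ger0P (t - L));
  case: (ger0P (2^-1 * (s + t) - L)); lra.
Qed.

(* Midpoints of covers are covers, so [psi_dist] makes a minimizing sequence
   Cauchy in mean; its pointwise limsup is again a cover. *)
Lemma minimal_cover : x < 1 -> fcov nu F W = (x / h%:R)%:E ->
  exists2 c, fractional_cover nu F W c & \int[nu]_y c y = x / h%:R.
Proof.
move=> x1 fE; have [K K0 KP] := cover_psi x1.
have /choice[c_ cP] : forall k : nat, exists c, fractional_cover nu F W c /\
    \int[nu]_y c y <= x / h%:R + 2^-1 ^+ k.
  move=> k; have : (fcov nu F W < (x / h%:R + 2^-1 ^+ k)%:E)%E.
    by rewrite fE lte_fin ltrDl exprn_gt0.
  move=> /ereal_inf_lt[_ [c cc <-]]; rewrite (bmeas_integralE nu (cover_bmeas cc)) lte_fin.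
  by move=> /ltW ?; exists c.
have cc k : fractional_cover nu F W (c_ k) by case: (cP k).
have c01 k y : 0 <= c_ k y <= 1 by case: (cc k).
have mc k : measurable_fun [set: T] (c_ k) by case: (cc k).
have bc k : bmeas (c_ k) := cover_bmeas (cc k).
(* The 6 is the factor 2 of [psi_dist] times three [psi] integrals, each at most [K * 2^-1 ^+ k]. *)
have dist k : \int[nu]_y `|c_ k.+1 y - c_ k y| <= 6 * K * 2^-1 ^+ k.
  pose m y := 2^-1 * (c_ k.+1 y + c_ k y).
  have cm : fractional_cover nu F W m by exact: midpoint_cover.
  have bm : bmeas m := cover_bmeas cm.
  apply: (@le_trans _ _ (2 * (\int[nu]_y psi l (c_ k.+1 y) +
      \int[nu]_y psi l (c_ k y) + \int[nu]_y psi l (m y)))).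
    have bp1 : bmeas (fun y => psi l (c_ k.+1 y) + psi l (c_ k y))
      by apply: bmeasD; exact: bmeas_psi.
    have bp2 : bmeas (fun y => psi l (m y)) by exact: bmeas_psi.
    rewrite -meanD; [|exact: bmeas_psi..].
    rewrite -meanD// -meanZ; last exact: bmeasD.
    apply: le_mean; [by apply: bmeas_norm; exact: bmeasB|by apply: bmeasZ; exact: bmeasD|].
    by apply: aeW => y; apply: psi_dist; [case/andP: (c01 k.+1 y)|case/andP: (c01 k y)].
  have e1 : \int[nu]_y psi l (c_ k y) <= K * 2^-1 ^+ k.
    apply: le_trans (KP _ (cc k)) _; apply: ler_wpM2l => //.
    by rewrite lerBlDl; case: (cP k).
  have ek : 2^-1 ^+ k.+1 <= 2^-1 ^+ k :> R.
    by rewrite exprS ler_piMl ?exprn_ge0//; lra.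
  have i2 : \int[nu]_y c_ k.+1 y <= x / h%:R + 2^-1 ^+ k.
    by case: (cP k.+1) => _ H; apply: le_trans H _; rewrite lerD2l.
  have e2 : \int[nu]_y psi l (c_ k.+1 y) <= K * 2^-1 ^+ k.
    apply: le_trans (KP _ (cc k.+1)) _; apply: ler_wpM2l => //.
    by rewrite lerBlDl.
  have e3 : \int[nu]_y psi l (m y) <= K * 2^-1 ^+ k.
    apply: le_trans (KP _ cm) _; apply: ler_wpM2l => //.
    rewrite /m meanZ; last exact: bmeasD.
    by rewrite meanD//; move: i2; case: (cP k) => _; lra.
  lra.
have cl := limsup_cover W_graphon cc.
exists (fun y => limn_sup (c_ ^~ y)) => //.
apply/eqP; rewrite eq_le cover_lower// andbT; apply/ler_addgt0Pl => e e0.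
(* The 1 is the excess of [c_ k] over [x / h]; the other term is the tail in [mean_limsup_le]. *)
pose C := 1 + 2 * (6 * K).
have C0 : 0 < C by rewrite ltr_pwDl// !mulr_ge0.
have [k ek] : exists k : nat, C * 2^-1 ^+ k <= e.
  have := @cvg_geometric R C 2^-1; rewrite ger0_norm//.
  have h12 : 2^-1 < 1 :> R by lra.
  move=> /(_ h12)/cvgrPdist_le/(_ _ e0)[k _ /(_ k (leqnn k))] /=.
  rewrite sub0r normrN ger0_norm; first by exists k.
  by rewrite mulr_ge0// ?ltW// exprn_gt0.
apply: le_trans (mean_limsup_le k mc c01 dist) _.
case: (cP k) => _ ck; move: ek; rewrite /C mulrDl mul1r mulrA.
set t := _ ^+ k in ck *; lra.
Qed.

End CoverBounds.

(** * Exact structure of extremal clique-free graphons *)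

Section Turan.
Local Open Scope classical_set_scope.
Local Open Scope ring_scope.
Context (R : realType) d (T : measurableType d).
Variables (nu : probability T R) (W : T * T -> R).
Hypothesis W_graphon : graphon W.
Variables (n : nat) (Z : set T) (beta : R).
Hypothesis mZ : measurable Z.
Hypothesis beta_gt0 : 0 < beta.
Hypothesis nuZ : fine (nu Z) = n.+1%:R * beta.
Hypothesis W_codegree : \forall t \ae nu, codegree nu W t <= beta.
Let clique k : set (k.-tuple T) := blowup W (fun _ : 'I_k => Z) id.
Hypothesis no_clique : \forall x \ae power_measure nu n.+2, ~ clique x.

Let maximal (x : n.+1.-tuple T) := \forall t \ae nu, ~ clique (tuple_cons (t, x)).

Let measurable_clique k : measurable (@clique k).
Proof. exact: measurable_blowup. Qed.

Lemma measurable_maximal : measurable [set x | maximal x].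
Proof.
apply: (measurable_ae_section nu
  (A := ~` ((fun z : n.+1.-tuple T * T => tuple_cons (z.2, z.1)) @^-1` @clique n.+2))).
apply: measurableC; apply: measurable_preimage; last exact: measurable_clique.
apply: (measurableT_comp (@measurable_tuple_cons _ T n.+1)).
exact: measurable_fun_pair.
Qed.

Lemma ae_maximal : \forall x \ae power_measure nu n.+1, maximal x.
Proof.
have [+ _] := ae_powerS_swap nu (measurableC (@measurable_clique n.+2)).
by apply; exact: no_clique.
Qed.

(* The codegrees of a maximal clique add up to at most the measure of [Z], and
   this is just enough to have a non-neighbour of each point of [Z]. *)
Lemma maximal_clique_codegrees (x : n.+1.-tuple T) : clique x -> maximal x ->
  (forall i, codegree nu W (tnth x i) <= beta) ->
  [/\ forall i, codegree nu W (tnth x i) = beta,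
      \forall t \ae nu, \sum_i (1 - W (tnth x i, t)) = \1_Z t &
      \forall t \ae nu, Z t -> exists i, W (tnth x i, t) = 0].
Proof.
move=> [xW xD] mx xb; have [_ W_sym W01] := W_graphon.
have nx : \forall t \ae nu, ~ (Z t /\ forall i, 0 < W (tnth x i, t)).
  apply: filterS mx => t nb [Zt tW]; apply: nb; split=> i.
    move=> j; case: (unliftP ord0 i) => [i'|] ->; case: (unliftP ord0 j) => [j'|] ->;
      rewrite ?tnth_tuple_consS ?tnth_tuple_cons0 ?eqxx//=.
    - by move=> ij; apply: xW; move: ij; rewrite (inj_eq lift_inj).
    - by rewrite W_sym.
  by case: (unliftP ord0 i) => [i'|] ->; rewrite ?tnth_tuple_consS ?tnth_tuple_cons0//=; exact: xD.
have [h1 h2] := uncovered_le W_graphon mZ xb nx.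
have sE : \sum_i codegree nu W (tnth x i) = n.+1%:R * beta.
  by apply/eqP; rewrite eq_le h2 -nuZ h1.
have bs : forall i : 'I_n.+1, bmeas (fun t => 1 - W (tnth x i, t)).
  by move=> i; exact: bmeas_cographon.
have ex : \forall t \ae nu, Z t -> exists i, W (tnth x i, t) = 0.
  apply: filterS nx => t nZ Zt; apply: contrapT => /forallNP nW; apply: nZ; split => // i.
  by rewrite lt_neqAle eq_sym; apply/andP; split; [exact/eqP/nW|case/andP: (W01 (tnth x i, t))].
split => //.
  move=> i; apply/eqP; rewrite eq_le xb/= leNgt; apply/negP => lt.
  have : \sum_i codegree nu W (tnth x i) < \sum_(i < n.+1) beta.
    by rewrite (bigD1 i)//= [ltRHS](bigD1 i)//= ltr_leD// ler_sum.
  by rewrite sE sumr_const card_ord mulr_natl ltxx.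
have bz : bmeas (\1_Z : T -> R) by exact: bmeas_indic.
(* The sum dominates the indicator of [Z] almost everywhere and both have mean [n.+1 * beta], so
   they agree. *)
suff : \forall t \ae nu, \sum_i (1 - W (tnth x i, t)) - \1_Z t = 0.
  by apply: filterS => t /eqP; rewrite subr_eq0 => /eqP.
apply: mean_eq0.
- by apply: bmeasB => //; exact: bmeas_sum.
- apply: filterS ex => t ex.
  have s0 i : 0 <= 1 - W (tnth x i, t) by rewrite subr_ge0; case/andP: (W01 (tnth x i, t)).
  rewrite subr_ge0 indicE; case: (boolP (t \in Z)) => [|_]; last exact: sumr_ge0.
  rewrite inE => /ex[i Wi].
  by rewrite (bigD1 i)//= Wi subr0 lerDl sumr_ge0.
- rewrite meanB//; last exact: bmeas_sum.
  by rewrite mean_sum// mean_indic// nuZ; have := sE; rewrite /codegree => ->; rewrite subrr.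
Qed.

(** For a generic clique [u] in [Z], the part [B i] consists of the points of [Z] that can replace
    [u_i]. The identity for the sum of the [1 - W] holds before and after the replacement, so a
    point of [B i] has the same neighbourhood as [u_i]. *)
Lemma turan_structure : exists B : 'I_n.+1 -> set T,
  [/\ forall i, measurable (B i),
      forall i j, i != j -> B i `&` B j = set0,
      forall i, fine (nu (B i)) = beta &
      forall i, \forall y \ae nu, B i y -> \forall t \ae nu, W (y, t) = 1 - \1_(B i) t].
Proof.
have [mW W_sym W01] := W_graphon.
(* Cliques of order [n.+1] in [Z] do not form a null set, whereas the other properties hold for
   almost every tuple. *)
have [u [[uW uD] mu ub muy]] : exists u : n.+1.-tuple T, [/\ clique u, maximal u,
    forall i, codegree nu W (tnth u i) <= beta &
    forall i, \forall y \ae nu, maximal (tset i y u)].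
  apply: contrapT => nex.
  apply: (@clique_exists _ _ _ nu W W_graphon beta n.+1 (fun=> Z) W_codegree) => //.
    move=> i; rewrite nuZ ltr_pM2r// ltr_nat; have := ltn_ord i; lia.
  have h1 := ae_maximal; have h2 := ae_tnth n.+1 W_codegree.
  have h3 : \forall x \ae power_measure nu n.+1, forall i, \forall y \ae nu, maximal (tset i y x).
    apply: filter_forall => i.
    have [+ _] := ae_resample nu i measurable_maximal; apply; exact: h1.
  near=> x => cx; apply: nex; exists x; split => //; near: x => //.
have [_ uS uE] := maximal_clique_codegrees (conj uW uD) mu ub.
have uC i := (let: And3 e _ _ := maximal_clique_codegrees (conj uW uD) mu ub in e i).
pose B i := [set y | [/\ Z y, W (tnth u i, y) = 0 &
  forall j, j != i -> W (tnth u j, y) = 1]].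
have mWu i a : measurable [set y | W (tnth u i, y) = a].
  apply: (measurable_preimage (f := fun y => W (tnth u i, y)) (A := [set a])) => //.
  by case: (bmeas_graphon W_graphon (tnth u i)).
have mB i : measurable (B i).
  rewrite (_ : B i = Z `&` [set y | W (tnth u i, y) = 0] `&`
     [set y | forall j, j != i -> W (tnth u j, y) = 1]); last first.
    by apply/seteqP; split => y /= [] // [].
  apply: measurableI; first exact: measurableI.
  apply: measurable_forall_ord => j.
  have [->|ji] := eqVneq j i.
    by rewrite [X in measurable X](_ : _ = setT)//; apply/seteqP; split.
  rewrite [X in measurable X](_ : _ = [set y | W (tnth u j, y) = 1])//.
  by apply/seteqP; split => y /=; [exact|].
(* The nonnegative terms [1 - W (tnth u i, t)] add up to the indicator of [Z]. On [Z] one of them is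
   1, so the others are 0; off [Z] all are 0. *)
have uB : \forall t \ae nu, forall i, 1 - W (tnth u i, t) = \1_(B i) t.
  near=> t => i.
  have St : \sum_i (1 - W (tnth u i, t)) = \1_Z t by near: t.
  have Et : Z t -> exists i, W (tnth u i, t) = 0 by near: t.
  have s0 j : 0 <= 1 - W (tnth u j, t) by rewrite subr_ge0; case/andP: (W01 (tnth u j, t)).
  have [Zt|nZt] := pselect (Z t); last first.
    have : \sum_i (1 - W (tnth u i, t)) = 0 by rewrite St indicE memNset.
    move/eqP; rewrite psumr_eq0// => /allP/(_ i (mem_index_enum _))/eqP ->.
    by rewrite indicE memNset// => -[].
  have [k Wk] := Et Zt.
  have Wj j : j != k -> 1 - W (tnth u j, t) = 0.
    move=> jk; have := St; rewrite indicE mem_set//= (bigD1 k)//= Wk subr0.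
    move/eqP; rewrite addrC -subr_eq0 addrK psumr_eq0// => /allP/(_ j (mem_index_enum _)).
    by rewrite jk => /eqP.
  have [->|ik] := eqVneq i k.
    rewrite Wk subr0 indicE mem_set//; split => // j jk.
    by have /eqP := Wj j jk; rewrite subr_eq0 => /eqP <-.
  rewrite (Wj i ik) indicE memNset// => -[_ Wi _].
  by have /eqP := Wj i ik; rewrite Wi subr0 oner_eq0.
exists B; split => //.
- move=> i j ij; apply/seteqP; split => // y [[_ Wi _] [_ _ /(_ i ij)]].
  by rewrite Wi => /esym/eqP; rewrite oner_eq0.
- move=> i; rewrite -mean_indic// -[RHS](uC i) /codegree.
  have bc := bmeas_cographon W_graphon (tnth u i); have bB := bmeas_indic R (mB i).
  apply/eqP; rewrite eq_le !le_mean//; apply: filterS uB => t /(_ i) -> //.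
move=> i; near=> y => -[Zy Wy Wj].
have y_codegree : codegree nu W y <= beta by near: y.
have y_maximal : maximal (tset i y u) by near: y; exact: muy.
have [] := @maximal_clique_codegrees (tset i y u) _ y_maximal.
- split=> [j k|j]; rewrite !tnth_mktuple; last by case: ifP.
  case: (eqVneq j i) => [->|ji]; case: (eqVneq k i) => [ki|ki];
    rewrite ?ki ?eqxx// => jk.
  + by rewrite W_sym Wj// ltr01.
  + by rewrite Wj// ltr01.
  + exact: uW.
- by move=> j; rewrite tnth_mktuple; case: ifP.
move=> _ yS _; near=> t.
have St : \sum_i (1 - W (tnth u i, t)) = \1_Z t by near: t.
have yt : \sum_j (1 - W (tnth (tset i y u) j, t)) = \1_Z t by near: t.
have Bt : forall i, 1 - W (tnth u i, t) = \1_(B i) t by near: t.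
(* The two sums agree and differ only in the term of index [i]; cancelling the others gives
   [W (y, t) = W (tnth u i, t)]. *)
rewrite -Bt; move: yt; rewrite -St (bigD1 i)//= [RHS](bigD1 i)//= tnth_mktuple eqxx.
rewrite (eq_bigr (fun j => 1 - W (tnth u j, t))); first by move/addIr; lra.
by move=> j ji; rewrite tnth_mktuple (negbTE ji).
Unshelve. all: by end_near. Qed.

End Turan.

(** * The critical chromatic number *)

Section BigMin.
Context (I : eqType) (s : seq I) (P : pred I) (F : I -> nat) (m : nat).

Lemma bigminn_le i : i \in s -> P i -> (\big[minn/m]_(j <- s | P j) F j <= F i)%N.
Proof.
elim: s => // a s' IH; rewrite inE big_cons => /predU1P[<- -> | js Pj].
  exact: geq_minl.
by case: ifP => _; [apply: leq_trans (geq_minr _ _) _|]; exact: IH.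
Qed.

Lemma bigminn_attained :
  \big[minn/m]_(j <- s | P j) F j = m \/
  exists2 i, P i & \big[minn/m]_(j <- s | P j) F j = F i.
Proof.
elim/big_ind : _ => [|a b Ha Hb|i Pi]; [by left| |by right; exists i].
by rewrite /minn; case: ifP.
Qed.

End BigMin.

Section OptimalColoring.
Variables (V : finType) (H : sgraph V).
Local Notation chi := (chromatic_number H).
Local Notation ell := (smallest_color_class H).
Hypothesis chi_gt0 : (0 < chi)%N.

Definition color_class (f : {ffun V -> 'I_chi}) i := [set v | f v == i]%SET.

Lemma smallest_color_class_le f i : proper_coloring H f ->
  (ell <= #|color_class f i|)%N.
Proof.
move=> Hf; rewrite /smallest_color_class.
apply: leq_trans (bigminn_le _ _ (mem_index_enum f) Hf) _.
exact: (bigminn_le (P := xpredT) _ _ (mem_index_enum i)).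
Qed.

Lemma optimal_coloring : exists2 f : {ffun V -> 'I_chi}, proper_coloring H f &
  exists i, #|color_class f i| = ell.
Proof.
have : colorable H chi by rewrite /chromatic_number; case: ex_minnP.
move=> /existsP[f Hf]; pose i0 := Ordinal chi_gt0.
(* If the minimum is the default value [#|V|], every colour class is all of [V], and any class of
   any proper colouring attains it. *)
have attained : ell = #|V| -> exists2 f : {ffun V -> 'I_chi}, proper_coloring H f &
    exists i, #|color_class f i| = ell.
  move=> e; exists f => //; exists i0; apply/eqP; rewrite eqn_leq smallest_color_class_le// andbT.
  by rewrite e max_card.
have [|[g Hg e]] := bigminn_attained (index_enum {ffun V -> 'I_chi})
  (@proper_coloring _ H chi)
  (fun f => \big[minn/#|V|]_(i < chi) #|[set v | f v == i]%SET|) #|V|.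
  exact: attained.
have [e'|[i _ e']] := bigminn_attained (index_enum 'I_chi) xpredT
  (fun i => #|[set v | g v == i]%SET|) #|V|.
  by apply: attained; rewrite /smallest_color_class e e'.
by exists g => //; exists i; rewrite /smallest_color_class e e'.
Qed.

Lemma color_class_gt0 f i : proper_coloring H f -> (0 < #|color_class f i|)%N.
Proof.
move=> Hf; rewrite lt0n; apply/negP => /eqP/cards0_eq c0.
have fi v : i != f v.
  by apply/eqP => e; have : v \in color_class f i; [rewrite inE -e|rewrite c0 inE].
have [k chiE] : exists k, chi = k.+1 by exists chi.-1; rewrite prednK.
move: f i Hf fi {c0}; rewrite chiE => f i /forallP Hf fi.
have : colorable H k.
  apply/existsP; exists [ffun v => s2val (unlift_some (fi v))].
  apply/forallP => u; apply/forallP => v; apply/implyP => uv; rewrite !ffunE.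
  have /forallP/(_ v) := Hf u; rewrite uv /=; apply: contraNneq => e.
  rewrite (s2valP (unlift_some (fi u))) (s2valP (unlift_some (fi v))).
  by apply/eqP; congr lift.
move: chiE; rewrite /chromatic_number; case: ex_minnP => m _ kmin mE /kmin.
by rewrite mE ltnn.
Qed.

Lemma sum_color_class (f : {ffun V -> 'I_chi}) : (\sum_i #|color_class f i| = #|V|)%N.
Proof.
rewrite -sum1_card (partition_big f xpredT)//=; apply: eq_bigr => i _.
by rewrite -sum1_card; apply: eq_bigl => v; rewrite inE.
Qed.

Lemma chi_ell_le : (chi * ell <= #|V|)%N.
Proof.
have [f Hf _] := optimal_coloring.
rewrite -(sum_color_class f) -[X in (X * _)%N](card_ord chi) -sum_nat_const.
by apply: leq_sum => i _; exact: smallest_color_class_le.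
Qed.

Lemma ell_gt0 : (0 < ell)%N.
Proof. by have [f Hf [i <-]] := optimal_coloring; exact: color_class_gt0. Qed.

End OptimalColoring.

Section OrdColoring.
Variables (V : finType) (H : sgraph V) (n : nat).
Hypothesis chiE : chromatic_number H = n.+2.

(** A transposition of colours moves a smallest class to [ord0], the colour fixed by the
    rotations. *)
Lemma ord_coloring : exists f : 'I_#|V| -> 'I_n.+2,
  (forall i j, ord_graph H i j -> f i != f j) /\
  #|[set i | f i == ord0]%SET| = smallest_color_class H.
Proof.
have chi0 : (0 < chromatic_number H)%N by rewrite chiE.
have [f /forallP Hf [i0 <-]] := optimal_coloring chi0.
rewrite /color_class; move: f i0 Hf; rewrite chiE => f i0 Hf.
exists (fun i => tperm i0 ord0 (f (enum_val i))); split=> [i j ij|].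
  rewrite (inj_eq perm_inj); have /forallP/(_ (enum_val j)) := Hf (enum_val i).
  by move/implyP; exact.
rewrite -(card_imset _ enum_val_inj); apply: eq_card => v; rewrite inE.
apply/imsetP/idP => [[i]|fv].
  rewrite inE => /eqP e ->; apply/eqP; apply: (@perm_inj _ (tperm i0 ord0)).
  by rewrite e tpermL.
exists (enum_rank v); last by rewrite enum_rankK.
by rewrite inE enum_rankK (eqP fv) tpermL.
Qed.

Section CriticalNumber.
Local Open Scope ring_scope.
Variable R : realType.
Local Notation ell := (smallest_color_class H).
Local Notation chicr := (critical_chromatic_number H R).

Lemma ell_bounds : (0 < ell)%N /\ (n.+2 * ell <= #|V|)%N.
Proof.
have chi0 : (0 < chromatic_number H)%N by rewrite chiE.
by rewrite -chiE; split; [exact: ell_gt0|exact: chi_ell_le].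
Qed.

Lemma ell_ltV : (ell < #|V|)%N.
Proof. by have [] := ell_bounds; lia. Qed.

Lemma critical_chromatic_numberE :
  chicr = n.+1%:R * #|V|%:R / (#|V|%:R - ell%:R).
Proof. by rewrite /critical_chromatic_number chiE -[n.+2]addn1 natrD addrK. Qed.

(** The strict lower bound amounts to [0 < ell], the upper bound to [n.+2 * ell <= #|V|]. *)
Lemma ceil_critical_chromatic_number : `|Num.ceil chicr|%N = n.+2.
Proof.
have [l0 nl] := ell_bounds; have lh := ell_ltV.
have hl : (0 : R) < #|V|%:R - ell%:R by rewrite subr_gt0 ltr_nat.
rewrite (_ : Num.ceil chicr = n.+2%:Z)//; apply: ceil_def.
rewrite critical_chromatic_numberE.
have -> : (n.+2%:Z - 1)%:~R = n.+1%:R :> R by rewrite -[n.+2]addn1 PoszD addrK.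
rewrite ltr_pdivlMr// ler_pdivrMr//; apply/andP; split.
  by rewrite ltr_pM2l ?ltr0n// ltrBlDr ltrDl ltr0n.
have : (n.+2%:R * ell%:R : R) <= #|V|%:R by rewrite -natrM ler_nat.
rewrite -[n.+2%:~R]/(n.+2%:R) -[n.+2]addn1 natrD.
set a := n.+1%:R; set h := #|V|%:R; set l := ell%:R; lra.
Qed.

End CriticalNumber.
End OrdColoring.

(** * From minimum degree to codegrees, and from the parts [B i] to a bottleneck graphon *)

Section Assembly.
Local Open Scope classical_set_scope.
Local Open Scope ring_scope.
Context (R : realType) d (T : measurableType d).
Variables (nu : probability T R) (W : T * T -> R).
Hypothesis W_graphon : graphon W.

Lemma codegree_min_degree (delta : R) : (delta%:E <= min_degree nu W)%E ->
  \forall t \ae nu, codegree nu W t <= 1 - delta.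
Proof.
move=> /ess_infP; apply: filterS => t; rewrite /degree.
have bW := bmeas_graphon W_graphon t.
rewrite (bmeas_integralE nu bW) lee_fin => h.
rewrite /codegree meanB//; last exact: bmeas_cst.
by rewrite mean_cst lerB.
Qed.

(** Almost everywhere [c] takes only the values 0 and [1 / l], so the indicator of [{c < b}] equals
    [1 - l * c]. *)
Lemma integral_cover_set (c : T -> R) (l b I : R) : bmeas c -> 0 < l -> 0 < b < l^-1 ->
  (\forall y \ae nu, c y = 0 \/ c y = l^-1) -> \int[nu]_y c y = I ->
  fine (nu [set y | c y < b]) = 1 - l * I.
Proof.
move=> bc l0 /andP[b0 bl] c2 <-; have mL := measurable_lt b bc.1.
rewrite -mean_indic// -(meanZ nu l bc) -[in RHS](mean_cst nu 1) -meanB//; last 2 first.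
- exact: bmeas_cst.
- exact: bmeasZ.
have b1 := bmeas_indic R mL.
have b2 : bmeas (fun y => 1 - l * c y) by apply: bmeasB; [exact: bmeas_cst|exact: bmeasZ].
have e : \forall y \ae nu, \1_[set y | c y < b] y = 1 - l * c y.
  apply: filterS c2 => y; rewrite indicE => -[] cy; rewrite cy.
    by rewrite mulr0 subr0 mem_set//= cy.
  by rewrite divff ?gt_eqF// subrr memNset//= cy; apply/negP; rewrite -leNgt ltW.
by apply/eqP; rewrite eq_le !le_mean//; apply: filterS e => y ->.
Qed.

(** The complement of the union of the [B i] becomes the last part, [ord_max]. In each condition on
    [W] the first index is not [ord_max], so the description of [W (y, t)] for [y] in [B i] gives
    the value. *)
Lemma bottleneck_of_structure n (B : 'I_n.+1 -> set T) (x chicr p : R) :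
  `|Num.ceil chicr|%N = n.+2 -> chicr != 0 ->
  x * (chicr + 1 - n.+2%:R) / chicr = p ->
  (forall i, measurable (B i)) ->
  (forall i j, i != j -> B i `&` B j = set0) ->
  (forall i, fine (nu (B i)) = (1 - p) / n.+1%:R) ->
  (forall i, \forall y \ae nu, B i y -> \forall t \ae nu, W (y, t) = 1 - \1_(B i) t) ->
  bottleneck_graphon nu W x chicr.
Proof.
move=> rE chicr0 pE mB disjB nuB WB; rewrite /bottleneck_graphon rE.
have [mW _ _] := W_graphon.
pose U := \bigcup_(j in [set: 'I_n.+1]) B j.
have mU : measurable U by exact: fin_bigcup_measurable.
pose P (i : 'I_n.+2) := if unlift ord_max i is Some j then B j else ~` U.
have mP i : measurable (P i) by rewrite /P; case: unlift => // *; exact: measurableC.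
have PB j : P (lift ord_max j) = B j by rewrite /P liftK.
have Pm : P ord_max = ~` U by rewrite /P unlift_none.
have n0 : n.+1%:R != 0 :> R by rewrite pnatr_eq0.
have nuU : fine (nu (~` U)) = p.
  have bs : forall j, bmeas (\1_(B j) : T -> R) by move=> j; exact: bmeas_indic.
  rewrite -mean_indic; last exact: measurableC.
  rewrite (@eq_Rintegral _ _ _ nu _ (fun y => 1 - \sum_j \1_(B j) y)); last first.
    move=> y _; rewrite indicE; have [[j _ Bj]|nU] := pselect (U y).
      rewrite memNset; last by move=> /(_ (ex_intro2 _ _ j Logic.I Bj)).
      rewrite (bigD1 j)//= indicE mem_set// big1 ?addr0 ?subrr// => k kj.
      rewrite indicE memNset// => Bk.
      by have : (B k `&` B j) y by []; rewrite disjB.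
    rewrite mem_set// big1 ?subr0// => j _; rewrite indicE memNset// => Bj.
    by apply: nU; exists j.
  rewrite meanB; [|exact: bmeas_cst|exact: bmeas_sum].
  rewrite mean_cst mean_sum//.
  under eq_bigr do rewrite (mean_indic nu (mB _)) nuB.
  rewrite sumr_const card_ord -[_ *+ _]mulr_natr divfK//; ring.
have sep i j y t : i != j -> P i y -> P j t ->
    \1_(P i) t = 0 :> R.
  move=> ij _; rewrite /P; case: (unliftP ord_max i) ij => [i'|] ->;
    case: (unliftP ord_max j) => [j'|] ->.
  - rewrite (inj_eq lift_inj) eq_sym => ij Bj; rewrite indicE memNset// => Bi.
    by have : (B j' `&` B i') t by []; rewrite disjB.
  - by move=> _ nU; rewrite indicE memNset// => Bi; apply: nU; exists i'.
  - by move=> _ Bj; rewrite indicE memNset//; apply; exists j'.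
  - by rewrite eqxx.
have aeP i j a : i != ord_max ->
    (forall y t, P i y -> P j t -> 1 - \1_(P i) t = a) ->
    {ae (nu \x nu)%E, forall z, (P i `*` P j) z -> W z = a}.
  case: (unliftP ord_max i) => [i'|] ->; last by rewrite eqxx.
  move=> _ aE.
  have mA : measurable [set z | (P (lift ord_max i') `*` P j) z -> W z = a].
    rewrite (_ : [set z | _] = ~` (P (lift ord_max i') `*` P j) `|` (W @^-1` [set a])).
      apply: measurableU; first by apply: measurableC; exact: measurableX.
      exact: measurable_preimage.
    apply/seteqP; split => z /=; last by case.
    by move=> h; have [Pz|] := pselect ((P (lift ord_max i') `*` P j) z); [right; exact: h|left].
  have [_] := ae_prod1P nu nu mA; apply.
  apply: filterS (WB i') => y hy.
  have [By|nBy] := pselect (B i' y); last by apply: aeW => t /= [] /=; rewrite PB.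
  apply: filterS (hy By) => t Wt /= [/= Piy Pjt]; rewrite Wt.
  by have := aE y t Piy Pjt; rewrite PB.
have lt_max (i : 'I_n.+2) : (i.+1 < n.+2)%N -> i != ord_max.
  by move=> h; apply/eqP => e; move: h; rewrite e ltnn.
exists P; split; split.
- exact: mP.
- apply/trivIsetP => i j _ _ ij; apply/seteqP; split => // y [Pi Pj].
  have := sep i j y y ij Pi Pj; rewrite indicE mem_set// => /eqP.
  by rewrite oner_eq0.
- apply/seteqP; split => // y _; have [[j _ Bj]|nU] := pselect (U y).
    by exists (lift ord_max j) => //; rewrite PB.
  by exists ord_max => //; rewrite Pm.
- move=> i [ir]; rewrite (_ : i = ord_max); last exact: ord_inj.
  by rewrite Pm -prob_fineK ?nuU ?pE//; exact: measurableC.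
- move=> i /lt_max; case: (unliftP ord_max i) => [j|] ->; last by rewrite eqxx.
  move=> _; rewrite PB -prob_fineK// nuB -pE; congr EFin.
  have -> : n.+2%:R - 1 = n.+1%:R :> R by rewrite -[n.+2]addn1 natrD addrK.
  by move: n.+1%:R n0 => m n0; field; rewrite n0 chicr0.
- move=> i j ij; apply: aeP.
    by apply: lt_max; rewrite ltnS; apply: leq_trans ij _; rewrite -ltnS.
  move=> y t Pi Pj; rewrite (sep i j y t)// ?subr0//.
  by apply/eqP => e; rewrite e ltnn in ij.
- move=> i /lt_max im; apply: aeP => // y t _ Pi.
  by rewrite indicE mem_set// subrr.
Qed.

End Assembly.

(** * The lower bound and the case of equality *)

Local Open Scope ring_scope.

Theorem theorem4p3 (R : realType) (d : measure_display) (T : measurableType d)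
    (nu : probability T R) (T_borel : standard_borel R T)
    (nu_atomless : atomless nu)
    (V : finType) (H : sgraph V) (chi_ge2 : (2 <= chromatic_number H)%N)
    (x : R) (x01 : 0 <= x <= 1)
    (W : T * T -> R) (W_graphon : graphon W)
    (W_min_degree :
      ((x * (1 - 1 / critical_chromatic_number H R) +
        (1 - x) * (1 - 1 / ((chromatic_number H)%:R - 1)))%:E
        <= min_degree nu W)%E) :
  ((x / #|V|%:R)%:E <= fcov nu (ord_graph H) W)%E /\
  (x < 1 -> fcov nu (ord_graph H) W = (x / #|V|%:R)%:E ->
    bottleneck_graphon nu W x (critical_chromatic_number H R)).
Proof.
have [n chiE] : exists n, chromatic_number H = n.+2.
  by exists (chromatic_number H).-2; case: (chromatic_number H) chi_ge2 => [|[]].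
set l := smallest_color_class H; set h := #|V|.
have [f [fF fl]] := ord_coloring chiE.
have [l0 nl] := ell_bounds chiE; have lh := ell_ltV chiE.
have lR0 : 0 < l%:R :> R by rewrite ltr0n.
have hl0 : 0 < h%:R - l%:R :> R by rewrite subr_gt0 ltr_nat.
have hR0 : 0 < h%:R :> R by rewrite ltr0n (leq_ltn_trans _ lh).
have n0 : n.+1%:R != 0 :> R by rewrite pnatr_eq0.
have n2 : n.+2%:R = n.+1%:R + 1 :> R by rewrite -[n.+2]addn1 natrD.
have chicrE := critical_chromatic_numberE chiE R.
pose p : R := x * l%:R / h%:R.
have W_codegree : {ae nu, forall t, codegree nu W t <= (1 - p) / n.+1%:R}.
  have := codegree_min_degree W_graphon W_min_degree; apply: filterS => t.
  move=> Wt; apply: le_trans Wt _; rewrite le_eqVlt; apply/orP; left; apply/eqP.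
  (* With [chicr = n.+1 * h / (h - l)], one minus the degree bound is exactly [(1 - p) / n.+1]. *)
  rewrite chicrE chiE n2 addrK /p -/l -/h.
  by move: n.+1%:R n0 => m n0; field; rewrite n0 !gt_eqF.
have l0' : (0 < #|[set i | f i == ord0]%SET|)%N by rewrite fl.
have lh' : (#|[set i | f i == ord0]%SET| < h)%N by rewrite fl.
have W_codegree' : {ae nu, forall t, codegree nu W t <=
    (1 - x * #|[set i | f i == ord0]%SET|%:R / h%:R) / n.+1%:R} by rewrite fl.
have := cover_lower W_graphon fF l0' lh' x01 W_codegree'; rewrite -/h => lower.
split=> [|x1 fE].
  apply: le_ereal_inf_tmp => _ [c cc <-].
  by rewrite (bmeas_integralE nu (cover_bmeas cc)) lee_fin lower.
have [c cc cI] := minimal_cover W_graphon fF l0' lh' x01 W_codegree' x1 fE.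
have [K _] := cover_psi W_graphon fF l0' lh' x01 W_codegree' x1.
rewrite fl -/l => KP.
have bc := cover_bmeas cc; have [mc c01 cF] := cc.
have c2 : {ae nu, forall y, c y = 0 \/ c y = l%:R^-1}.
  have : {ae nu, forall y, psi l (c y) = 0}.
    apply: mean_eq0; first exact: bmeas_psi.
      apply: aeW => y; rewrite /psi le_min normr_ge0 andbT.
      by case/andP: (c01 y).
    by apply: le_trans (KP c cc) _; rewrite cI subrr mulr0.
  apply: filterS => y; rewrite /psi; case: (leP (c y)) => _; first by left.
  by move/eqP; rewrite normr_eq0 subr_eq0 => /eqP; right.
(* Below [1 / l], so that [{c < b}] is the zero set of [c] up to a null set; and [h] vertices of
   weight [b] total 1 / 2, as [cover_no_clique] allows. *)
pose b : R := (2 * h%:R)^-1.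
have b0 : 0 < b by rewrite invr_gt0 mulr_gt0.
have bl : 0 < b < l%:R^-1.
  by rewrite b0 ltf_pV2 ?posrE ?mulr_gt0//; move: hl0; lra.
have := integral_cover_set bc lR0 bl c2 cI.
have -> : 1 - l%:R * (x / h%:R) = n.+1%:R * ((1 - p) / n.+1%:R).
  by rewrite /p; move: n.+1%:R n0 => m n0; field; rewrite n0 gt_eqF.
move=> nuZ.
have be0 : 0 < (1 - p) / n.+1%:R.
  by have := beta_gt0 l0' lh' x01; rewrite fl.
have noK : {ae power_measure nu n.+2, forall y,
    ~ blowup W (fun=> [set y | c y < b]%classic) id y}.
  apply: (cover_no_clique W_graphon (b := fun=> b) (f := f) _ cc fF).
    by rewrite (leq_ltn_trans _ lh).
  by rewrite sumr_const card_ord -[_ *+ _]mulr_natr /b invfM mulfVK ?gt_eqF//; lra.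
have [B [mB disjB nuB WB]] :=
  turan_structure W_graphon (measurable_lt b mc) be0 nuZ W_codegree noK.
apply: (bottleneck_of_structure W_graphon (p := p)) mB disjB nuB WB.
- exact: ceil_critical_chromatic_number.
- by rewrite chicrE mulf_neq0 ?mulf_neq0 ?invr_eq0 ?gt_eqF.
- rewrite chicrE n2 /p -/l -/h.
  by move: n.+1%:R n0 => m n0; field; rewrite n0 !gt_eqF.
Qed.
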